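(* Let $H$ be a projective Hopf algebra and $A,B,C$ right $H$-comodule algebras. If $M\in{}_A\mathcal{M}_B^H$ and $N\in{}_A\mathcal{M}_C^H$, then ${}_A{\rm HOM}(M,N)\in{}_B\mathcal{M}_C^H$, where the $(B,C)$-bimodule structure is $(b\cdot f\cdot c)(m)=f(mb)c$. Every $f\in{}_A{\rm HOM}(M,N)^{{\rm co}H}$ maps $M^{{\rm co}H}$ into $N^{{\rm co}H}$, so restriction defines a map $$\beta:\ {}_A{\rm HOM}(M,N)^{{\rm co}H}\to{}_{A^{{\rm co}H}}{\rm Hom}(M^{{\rm co}H},N^{{\rm co}H}).$$ If $A$ is a right faithfully flat $H$-Galois extension, then $\beta$ is an isomorphism of left $B\square_H C^{\rm op}$-modules.
   Context: $k$ is a commutative ring, $H$ is a Hopf algebra over $k$ with bijective antipode $S$; ''projective'' means projective as a $k$-module. $\otimes=\otimes_k$. Right coactions are written $\rho(m)=m_{[0]}\otimes m_{[1]}$; $M^{{\rm co}H}=\{m\in M\mid\rho(m)=m\otimes 1\}$. ${}_A\mathcal{M}^H$: left $A$-modules and right $H$-comodules $M$ with $\rho(am)=a_{[0]}m_{[0]}\otimes a_{[1]}m_{[1]}$. ${}_A\mathcal{M}_B^H$: $(A,B)$-bimodules with right $H$-coaction satisfying $\rho(amb)=a_{[0]}m_{[0]}b_{[0]}\otimes a_{[1]}m_{[1]}b_{[1]}$; morphisms are $A$-linear, $B$-linear, $H$-colinear. For $M,N\in{}_A\mathcal{M}^H$, ${}_A{\rm HOM}(M,N)$ is the set of $f\in{}_A{\rm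 Hom}(M,N)$ for which there exists a (necessarily unique) $f_{[0]}\otimes f_{[1]}\in{}_A{\rm Hom}(M,N)\otimes H$ with $f_{[0]}(m)\otimes f_{[1]}=f(m_{[0]})_{[0]}\otimes S^{-1}(m_{[1]})f(m_{[0]})_{[1]}$ for all $m\in M$; it is a right $H$-comodule via $\rho(f)=f_{[0]}\otimes f_{[1]}$. $A$ is a right faithfully flat $H$-Galois extension if $A$ is faithfully flat as a right $A^{{\rm co}H}$-module and ${\rm can}':A\otimes_{A^{{\rm co}H}}A\to A\otimes H$, ${\rm can}'(a\otimes b)=a_{[0]}b\otimes a_{[1]}$, is bijective (equivalently ${\rm can}(a\otimes b)=ab_{[0]}\otimes b_{[1]}$ is bijective); then $(A\otimes_{A^{{\rm co}H}}-,(-)^{{\rm co}H})$ are inverse equivalences between ${}_{A^{{\rm co}H}}\mathcal{M}$ and ${}_A\mathcal{M}^H$. $C^{\rm op}$ is a left $H$-comodule algebra via $\lambda(c)=S^{-1}(c_{[1]})\otimes c_{[0]}$, and $B\square_H C^{\rm op}=\{\sum_i b_i\otimes c_i\in B\otimes C^{\rm op}\mid\sum_i\rho(b_i)\otimes c_i=\sum_i b_i\otimes\lambda(c_i)\}$, a subalgebra of $B\otimes C^{\rm op}$. For $X\in{}_B\mathcal{M}_C^H$, $X^{{\rm co}H}$ is a left $B\square_H C^{\rm op}$-module via $(\sum_i b_i\otimes c_i)\cdot x=\sum_i b_ixc_i$. When $A$ is right faithfully flat $H$-Galois, every $g\in{}_{A^{{\rm co}H}}{\rm Hom}(M^{{\rm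 co}H},N^{{\rm co}H})$ has a unique left $A$-linear $H$-colinear extension $\tilde g:M\to N$, and $B\square_H C^{\rm op}$ acts on ${}_{A^{{\rm co}H}}{\rm Hom}(M^{{\rm co}H},N^{{\rm co}H})$ by $\bigl((\sum_i b_i\otimes c_i)\cdot g\bigr)(m)=\sum_i\tilde g(mb_i)c_i$. *)

(* Defs.v *)
From HB Require Import structures.
From mathcomp Require Import all_boot all_algebra.
From mathcomp Require Import boolp functions.

Set Implicit Arguments.
Unset Strict Implicit.
Unset Printing Implicit Defensive.
Import GRing.Theory.
Local Open Scope ring_scope.
Local Open Scope quotient_scope.

Reserved Notation "x ⊗ y" (at level 40, left associativity).
Reserved Notation "x ⊗b y" (at level 40, left associativity).

(* The tensor product over R of a right R-module M and a left R-module N, the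
   actions being given by the functions r and l: finite formal sums of pairs
   (sequences), modulo the congruence generated by biadditivity and balance. *)
Section BalancedTensor.
Context {R : Type} {M N : zmodType}.
Variables (r : M -> R -> M) (l : R -> N -> N).

Inductive tensor_rel : seq (M * N) -> seq (M * N) -> Prop :=
| tensor_rel_refl s : tensor_rel s s
| tensor_rel_sym s t : tensor_rel s t -> tensor_rel t s
| tensor_rel_trans s t u : tensor_rel s t -> tensor_rel t u -> tensor_rel s u
| tensor_rel_cat s s' t t' : tensor_rel s s' -> tensor_rel t t' ->
    tensor_rel (s ++ t) (s' ++ t')
| tensor_rel_catC s t : tensor_rel (s ++ t) (t ++ s)
| tensor_rel_addl m m' n : tensor_rel [:: (m + m', n)] [:: (m, n); (m', n)]
| tensor_rel_addr m n n' : tensor_rel [:: (m, n + n')] [:: (m, n); (m, n')]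
| tensor_rel_0 n : tensor_rel [:: (0, n)] [::]
| tensor_rel_bal m a n : tensor_rel [:: (r m a, n)] [:: (m, l a n)].

Definition tensor_eqb : rel (seq (M * N)) := fun s t => `[< tensor_rel s t >].

Lemma tensor_eqb_refl : reflexive tensor_eqb.
Proof. by move=> s; apply/asboolP; apply: tensor_rel_refl. Qed.
Lemma tensor_eqb_sym : symmetric tensor_eqb.
Proof. by move=> s t; apply/asboolP/asboolP; apply: tensor_rel_sym. Qed.
Lemma tensor_eqb_trans : transitive tensor_eqb.
Proof.
move=> s t u /asboolP ts /asboolP su; apply/asboolP.
exact: tensor_rel_trans ts su.
Qed.

Canonical tensor_equiv :=
  EquivRel tensor_eqb tensor_eqb_refl tensor_eqb_sym tensor_eqb_trans.

Definition btensor := {eq_quot tensor_equiv}.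
HB.instance Definition _ := Choice.on btensor.
HB.instance Definition _ := EqQuotient.on btensor.

Lemma btensor_eqP s t : \pi_btensor s = \pi_btensor t <-> tensor_rel s t.
Proof. by split=> [/eqmodP/asboolP|h]; last exact/eqmodP/asboolP. Qed.

Lemma btensor_reprP s : tensor_rel (repr (\pi_btensor s)) s.
Proof. by apply/btensor_eqP; rewrite reprK. Qed.

Lemma btensorW (P : btensor -> Prop) :
  (forall s, P (\pi_btensor s)) -> forall x, P x.
Proof. by move=> PP x; rewrite -[x]reprK; apply: PP. Qed.

Definition btensor_zero : btensor := \pi_btensor [::].
Definition btensor_add (x y : btensor) : btensor := \pi_btensor (repr x ++ repr y).
Definition btensor_opp (x : btensor) : btensor :=
  \pi_btensor [seq (- p.1, p.2) | p <- repr x].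

Lemma btensor_addE s t :
  btensor_add (\pi_btensor s) (\pi_btensor t) = \pi_btensor (s ++ t).
Proof.
by apply/btensor_eqP; apply: tensor_rel_cat; apply: btensor_reprP.
Qed.

Fact btensor_addA : associative btensor_add.
Proof.
elim/btensorW=> s; elim/btensorW=> t; elim/btensorW=> u; rewrite !btensor_addE.
by rewrite catA.
Qed.
Fact btensor_addC : commutative btensor_add.
Proof.
elim/btensorW=> s; elim/btensorW=> t; rewrite !btensor_addE.
by apply/btensor_eqP; apply: tensor_rel_catC.
Qed.
Fact btensor_add0 : left_id btensor_zero btensor_add.
Proof. by elim/btensorW=> s; rewrite btensor_addE. Qed.
Fact btensor_addN : left_inverse btensor_zero btensor_opp btensor_add.
Proof.
move=> x; rewrite -{2}[x]reprK btensor_addE; apply/btensor_eqP.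
elim: (repr x) => [|[m n] s IHs] /=; first exact: tensor_rel_refl.
set s' := [seq _ | _ <- s] in IHs *.
apply: (@tensor_rel_trans _ ([:: (- m, n); (m, n)] ++ (s' ++ s))).
  rewrite -![_ :: s]cat1s -![_ :: (s' ++ _)]cat1s -[[:: _; _]]cat1s -catA.
  apply: tensor_rel_cat; first exact: tensor_rel_refl.
  rewrite !catA; apply: tensor_rel_cat; last exact: tensor_rel_refl.
  exact: tensor_rel_catC.
rewrite -[[::]]cats0; apply: tensor_rel_cat => //.
apply: (@tensor_rel_trans _ [:: (- m + m, n)]).
  by apply: tensor_rel_sym; apply: tensor_rel_addl.
by rewrite addNr; apply: tensor_rel_0.
Qed.

HB.instance Definition _ := GRing.isZmodule.Build btensor
  btensor_addA btensor_addC btensor_add0 btensor_addN.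

Definition btens (m : M) (n : N) : btensor := \pi_btensor [:: (m, n)].

Lemma btensor_piE s : \pi_btensor s = \sum_(p <- s) btens p.1 p.2.
Proof.
elim: s => [|[m n] s IHs]; first by rewrite big_nil.
by rewrite big_cons -IHs [RHS]btensor_addE.
Qed.

Lemma btensorE (x : btensor) : x = \sum_(p <- repr x) btens p.1 p.2.
Proof. by rewrite -[LHS]reprK btensor_piE. Qed.

Lemma btensDl m m' n : btens (m + m') n = btens m n + btens m' n.
Proof.
transitivity (\pi_btensor [:: (m, n); (m', n)]).
  by apply/btensor_eqP; apply: tensor_rel_addl.
by rewrite btensor_piE !big_cons big_nil addr0.
Qed.
Lemma btensDr m n n' : btens m (n + n') = btens m n + btens m n'.
Proof.
transitivity (\pi_btensor [:: (m, n); (m, n')]).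
  by apply/btensor_eqP; apply: tensor_rel_addr.
by rewrite btensor_piE !big_cons big_nil addr0.
Qed.
Lemma btens_bal m a n : btens (r m a) n = btens m (l a n).
Proof. by apply/btensor_eqP; apply: tensor_rel_bal. Qed.

Lemma btensor_ind (P : btensor -> Prop) : P 0 ->
  (forall x y, P x -> P y -> P (x + y)) -> (forall m n, P (btens m n)) ->
  forall x, P x.
Proof.
move=> P0 PD PT x; rewrite [x]btensorE.
by elim/big_ind: _ => // p _; apply: PT.
Qed.

(* blift f is the additive map with value f m n on the tensor m ⊗ n; its
   definition makes sense for every f, but it has this property only when f is
   biadditive and balanced. *)
Definition blift {P : zmodType} (f : M -> N -> P) (x : btensor) : P :=
  \sum_(p <- repr x) f p.1 p.2.

Definition balanced {P : zmodType} (f : M -> N -> P) : Prop :=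
  [/\ forall m m' n, f (m + m') n = f m n + f m' n,
      forall m n n', f m (n + n') = f m n + f m n'
    & forall m a n, f (r m a) n = f m (l a n)].

Section BLift.
Context {P : zmodType} (f : M -> N -> P) (fB : balanced f).

Lemma blift_pi s : blift f (\pi_btensor s) = \sum_(p <- s) f p.1 p.2.
Proof.
case: fB => fDl fDr fb; rewrite /blift.
suff sum_rel u v : tensor_rel u v ->
    \sum_(p <- u) f p.1 p.2 = \sum_(p <- v) f p.1 p.2.
  exact: sum_rel (btensor_reprP s).
elim=> {u v s} //.
- by move=> s t u _ -> _ ->.
- by move=> s s' t t' _ hs _ ht; rewrite !big_cat /= hs ht.
- by move=> s t; rewrite !big_cat /= addrC.
- by move=> m m' n; rewrite !big_cons !big_nil !addr0 fDl.
- by move=> m n n'; rewrite !big_cons !big_nil !addr0 fDr.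
- move=> n; rewrite big_cons !big_nil addr0 /=.
  by apply: (addrI (f 0 n)); rewrite -fDl !addr0.
- by move=> m a n; rewrite !big_cons !big_nil !addr0 fb.
Qed.

Lemma blift_btens m n : blift f (btens m n) = f m n.
Proof. by rewrite blift_pi big_cons big_nil addr0. Qed.

Lemma bliftD : {morph blift f : x y / x + y}.
Proof.
elim/btensorW=> s; elim/btensorW=> t.
by rewrite [X in blift f X]btensor_addE !blift_pi big_cat.
Qed.
End BLift.

End BalancedTensor.
Arguments btens {R M N r l} m n.
Arguments blift {R M N r l P} f x.

Section Tensor.
Context {k : comPzRingType}.
Implicit Types M N P U V : lmodType k.

Definition tensor M N : Type :=
  @btensor k M N (fun m a => a *: m) (fun a n => a *: n).

HB.instance Definition _ M N := GRing.Zmodule.on (tensor M N).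

Local Notation "M ⊗ N" := (tensor M N) : type_scope.

Definition tens M N (m : M) (n : N) : M ⊗ N := btens m n.
Local Notation "m ⊗ n" := (tens m n) : ring_scope.

Definition tlift M N P (f : M -> N -> P) (x : M ⊗ N) : P := blift f x.

Definition bilinear_map M N P (f : M -> N -> P) : Prop :=
  (forall n, linear (f^~ n)) /\ (forall m, linear (f m)).

Lemma linearPD U V (f : U -> V) : linear f -> {morph f : x y / x + y}.
Proof. by move=> fL x y; rewrite -[x]scale1r fL !scale1r. Qed.
Lemma linearP0 U V (f : U -> V) : linear f -> f 0 = 0.
Proof.
move=> fL; have /eqP := linearPD fL 0 0.
by rewrite addr0 addrC -subr_eq subrr => /eqP.
Qed.
Lemma linearPZ U V (f : U -> V) : linear f -> forall a x, f (a *: x) = a *: f x.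
Proof. by move=> fL a x; rewrite -[a *: x]addr0 fL (linearP0 fL) addr0. Qed.

Lemma bilinear_balanced M N P (f : M -> N -> P) : bilinear_map f ->
  balanced (fun m (a : k) => a *: m) (fun a n => a *: n) f.
Proof.
case=> fl fr; split=> [m m' n|m n n'|m a n].
- exact: (linearPD (fl n)).
- exact: (linearPD (fr m)).
- by rewrite (linearPZ (fl n)) (linearPZ (fr m)).
Qed.

Lemma tlift_tens M N P (f : M -> N -> P) (m : M) (n : N) :
  bilinear_map f -> tlift f (m ⊗ n) = f m n.
Proof. by move/bilinear_balanced=> fB; apply: blift_btens. Qed.

Lemma tliftD M N P (f : M -> N -> P) :
  bilinear_map f -> {morph tlift f : x y / x + y}.
Proof. by move/bilinear_balanced=> fB; apply: bliftD. Qed.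

Lemma tensDl M N (m m' : M) (n : N) : (m + m') ⊗ n = m ⊗ n + m' ⊗ n.
Proof. exact: btensDl. Qed.
Lemma tensDr M N (m : M) (n n' : N) : m ⊗ (n + n') = m ⊗ n + m ⊗ n'.
Proof. exact: btensDr. Qed.
Lemma tensZ M N a (m : M) (n : N) : (a *: m) ⊗ n = m ⊗ (a *: n).
Proof. exact: btens_bal. Qed.

Lemma tensor_ind M N (P : M ⊗ N -> Prop) : P 0 ->
  (forall x y, P x -> P y -> P (x + y)) -> (forall m n, P (m ⊗ n)) ->
  forall x, P x.
Proof. exact: btensor_ind. Qed.

Section TensorLmod.
Variables M N : lmodType k.

Definition tensor_scale (a : k) (x : M ⊗ N) : M ⊗ N :=
  blift (fun m n => (a *: m) ⊗ n) x.

Lemma tensor_scale_bal a :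
  balanced (fun m (a : k) => a *: m) (fun a n => a *: n)
           (fun (m : M) (n : N) => (a *: m) ⊗ n).
Proof.
split=> [m m' n|m n n'|m b n].
- by rewrite scalerDr tensDl.
- by rewrite tensDr.
- by rewrite -tensZ !scalerA mulrC.
Qed.

Lemma tensor_scaleDr a : {morph tensor_scale a : x y / x + y}.
Proof. exact: bliftD (tensor_scale_bal a). Qed.
Lemma tensor_scaleE a m n : tensor_scale a (m ⊗ n) = (a *: m) ⊗ n.
Proof. exact: blift_btens (tensor_scale_bal a) m n. Qed.
Lemma tensor_scale0 a : tensor_scale a 0 = 0.
Proof. by apply: (addrI (tensor_scale a 0)); rewrite -tensor_scaleDr !addr0. Qed.

Fact tensor_scaleA a b x :
  tensor_scale a (tensor_scale b x) = tensor_scale (a * b) x.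
Proof.
elim/tensor_ind: x => [|x y IHx IHy|m n]; first by rewrite !tensor_scale0.
  by rewrite !tensor_scaleDr IHx IHy.
by rewrite !tensor_scaleE scalerA.
Qed.
Fact tensor_scale1 : left_id 1 tensor_scale.
Proof.
elim/tensor_ind=> [|x y IHx IHy|m n]; first by rewrite !tensor_scale0.
  by rewrite !tensor_scaleDr IHx IHy.
by rewrite !tensor_scaleE scale1r.
Qed.
Fact tensor_scaleDl x : {morph tensor_scale^~ x : a b / a + b}.
Proof.
move=> a b; elim/tensor_ind: x => [|x y IHx IHy|m n] /=.
- by rewrite !tensor_scale0 addr0.
- by rewrite !tensor_scaleDr IHx IHy addrACA.
- by rewrite !tensor_scaleE scalerDl tensDl.
Qed.

HB.instance Definition _ := GRing.Zmodule_isLmodule.Build k (tensor M N)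
  tensor_scaleA tensor_scale1 tensor_scaleDr tensor_scaleDl.

Lemma tensZl a (m : M) (n : N) : (a *: m) ⊗ n = a *: (m ⊗ n).
Proof. by rewrite -tensor_scaleE. Qed.
Lemma tensZr a (m : M) (n : N) : m ⊗ (a *: n) = a *: (m ⊗ n).
Proof. by rewrite -tensZ tensZl. Qed.

Lemma tlift_linear P (f : M -> N -> P) : bilinear_map f -> linear (tlift f).
Proof.
move=> fB a x y; rewrite (tliftD fB); congr (_ + _).
have f0 : tlift f 0 = 0.
  by apply: (addrI (tlift f 0)); rewrite -(tliftD fB) !addr0.
elim/tensor_ind: x => [|x z IHx IHz|m n]; first by rewrite scaler0 f0 scaler0.
  by rewrite scalerDr !(tliftD fB) IHx IHz scalerDr.
by rewrite -tensZl !tlift_tens // (linearPZ (fB.1 n)).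
Qed.
End TensorLmod.

End Tensor.

Notation "M ⊗ N" := (tensor M%type N%type) : type_scope.
Notation "m ⊗ n" := (tens m n) : ring_scope.

Section TensorMaps.
Context {k : comPzRingType}.
Implicit Types M N P U V : lmodType k.

Lemma lin_id U : linear (fun x : U => x).
Proof. by []. Qed.
Lemma lin_comp U V P (h : V -> P) (f : U -> V) :
  linear h -> linear f -> linear (fun x => h (f x)).
Proof. by move=> hL fL a x y; rewrite fL hL. Qed.
Lemma lin_tensl U M N (f : U -> M) (n : N) :
  linear f -> linear (fun x => f x ⊗ n).
Proof. by move=> fL a x y; rewrite fL tensDl tensZl. Qed.
Lemma lin_tensr U M N (m : M) (f : U -> N) :
  linear f -> linear (fun x => m ⊗ f x).
Proof. by move=> fL a x y; rewrite fL tensDr tensZr. Qed.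
Lemma lin_lift_arg U M N P (f : M -> N -> P) (g : U -> M ⊗ N) :
  bilinear_map f -> linear g -> linear (fun x => tlift f (g x)).
Proof. by move=> fB gL a x y; rewrite gL (tlift_linear fB). Qed.
Lemma lin_lift_fun U M N P (F : U -> M -> N -> P) (t : M ⊗ N) :
  (forall m n, linear (fun x => F x m n)) -> linear (fun x => tlift (F x) t).
Proof.
move=> FL a x y; rewrite /tlift /blift scaler_sumr -big_split /=.
by apply: eq_bigr => p _; rewrite FL.
Qed.
Lemma lin_bil1 U M N P (h : M -> N -> P) (f : U -> M) (n : N) :
  bilinear_map h -> linear f -> linear (fun x => h (f x) n).
Proof. by move=> [hl _] fL a x y; rewrite fL hl. Qed.
Lemma lin_bil2 U M N P (h : M -> N -> P) (f : U -> N) (m : M) :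
  bilinear_map h -> linear f -> linear (fun x => h m (f x)).
Proof. by move=> [_ hr] fL a x y; rewrite fL hr. Qed.
Lemma lin_scale U V (a : k) (f : U -> V) :
  linear f -> linear (fun x => a *: f x).
Proof. by move=> fL b x y; rewrite fL scalerDr !scalerA mulrC. Qed.
Lemma lin_scalel U V (f : U -> k) (v : V) :
  scalar f -> linear (fun x => f x *: v).
Proof. by move=> fL b x y; rewrite fL scalerDl scalerA. Qed.

Lemma tens0l M N (n : N) : (0 : M) ⊗ n = 0.
Proof. exact: (linearP0 (lin_tensl n (@lin_id M))). Qed.
Lemma tensBl M N (m m' : M) (n : N) : (m - m') ⊗ n = m ⊗ n - m' ⊗ n.
Proof. by rewrite -scaleN1r tensDl tensZl scaleN1r. Qed.

Lemma eq_tlift M N P (f g : M -> N -> P) (t : M ⊗ N) :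
  (forall m n, f m n = g m n) -> tlift f t = tlift g t.
Proof. by move=> fg; rewrite /tlift /blift; apply: eq_bigr. Qed.
Lemma tlift_id M N (t : M ⊗ N) : tlift (fun m n => m ⊗ n) t = t.
Proof. by rewrite [RHS]btensorE. Qed.
Lemma tlift_comp M N P U (h : P -> U) (f : M -> N -> P) (t : M ⊗ N) :
  linear h -> h (tlift f t) = tlift (fun m n => h (f m n)) t.
Proof.
move=> hL; rewrite /tlift /blift.
elim/big_rec2: _ => [|p x y _ <-]; first exact: linearP0.
exact: linearPD.
Qed.
Lemma tlift_exchange M N U V P (f : M -> N -> U -> V -> P) s (t : U ⊗ V) :
  tlift (fun m n => tlift (f m n) t) s =
  tlift (fun u v => tlift (fun m n => f m n u v) s) t.
Proof. exact: exchange_big. Qed.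

Definition tmap M N U V (f : M -> U) (g : N -> V) (x : M ⊗ N) : U ⊗ V :=
  tlift (fun m n => f m ⊗ g n) x.

Definition tmap2 M M' M'' N N' N'' (f : M -> M' -> M'') (g : N -> N' -> N'')
    (x : M ⊗ N) (y : M' ⊗ N') : M'' ⊗ N'' :=
  tlift (fun m n => tlift (fun m' n' => f m m' ⊗ g n n') y) x.

Definition tassoc M N P (x : (M ⊗ N) ⊗ P) : M ⊗ (N ⊗ P) :=
  tlift (fun t p => tlift (fun m n => m ⊗ (n ⊗ p)) t) x.

End TensorMaps.

(* The library's algType excludes the zero ring. *)
Record kalgebra (k : comPzRingType) := KAlgebra {
  kalg_ring : pzRingType;
  kalg_scale : k -> kalg_ring -> kalg_ring;
  kalg_scaleA : forall a b x,
    kalg_scale a (kalg_scale b x) = kalg_scale (a * b) x;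
  kalg_scale1 : left_id 1 kalg_scale;
  kalg_scaleDr : right_distributive kalg_scale +%R;
  kalg_scaleDl : forall x, {morph kalg_scale^~ x : a b / a + b};
  kalg_scaleAl : forall a x y, kalg_scale a (x * y) = kalg_scale a x * y;
  kalg_scaleAr : forall a x y, kalg_scale a (x * y) = x * kalg_scale a y
}.

Definition kalg_sort k (A : kalgebra k) : Type := kalg_ring A.
Coercion kalg_sort : kalgebra >-> Sortclass.

Section KAlgebraInstances.
Context {k : comPzRingType} (A : kalgebra k).
HB.instance Definition _ := GRing.PzRing.copy (kalg_sort A) (kalg_ring A).
HB.instance Definition _ := GRing.Zmodule_isLmodule.Build k (kalg_sort A)
  (@kalg_scaleA k A) (@kalg_scale1 k A) (@kalg_scaleDr k A) (@kalg_scaleDl k A).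
Lemma kscalerAl (a : k) (x y : A) : a *: (x * y) = (a *: x) * y.
Proof. exact: kalg_scaleAl. Qed.
Lemma kscalerAr (a : k) (x y : A) : a *: (x * y) = x * (a *: y).
Proof. exact: kalg_scaleAr. Qed.
End KAlgebraInstances.
Coercion Defs_kalg_sort__canonical__GRing_Lmodule :
  kalgebra >-> GRing.Lmodule.type.

Section LinMul.
Context {k : comPzRingType}.
Lemma lin_mull (U : lmodType k) (A : kalgebra k) (f : U -> A) (c : A) :
  linear f -> linear (fun x => f x * c).
Proof. by move=> fL a x y; rewrite fL mulrDl kscalerAl. Qed.
Lemma lin_mulr (U : lmodType k) (A : kalgebra k) (f : U -> A) (c : A) :
  linear f -> linear (fun x => c * f x).
Proof. by move=> fL a x y; rewrite fL mulrDr kscalerAr. Qed.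
Lemma mulr_bilinear (A : kalgebra k) : bilinear_map (@GRing.mul A).
Proof.
split=> c; first exact: (lin_mull c (@lin_id _ A)).
exact: (lin_mulr c (@lin_id _ A)).
Qed.
End LinMul.

Ltac lin :=
  intros; cbv beta;
  lazymatch goal with
  | |- bilinear_map _ => first [assumption | exact: mulr_bilinear | unfold tmap, tmap2, tassoc; split; lin]
  | |- GRing.linear_for _ _ =>
    first
    [ assumption
    | solve [auto 1 with nocore]
    | exact: linearP
    | exact: lin_id
    | match goal with
      | |- GRing.linear_for _ (fun x => tens (@?f x) ?n) => apply: (@lin_tensl _ _ _ _ f n); lin
      | |- GRing.linear_for _ (fun x => tens ?m (@?f x)) => apply: (@lin_tensr _ _ _ _ m f); lin
      | |- GRing.linear_for _ (fun x => tlift ?h (@?f x)) => apply: (@lin_lift_arg _ _ _ _ _ h f); lin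
      | |- GRing.linear_for _ (fun x => tlift (@?F x) ?t) => apply: (@lin_lift_fun _ _ _ _ _ F t); lin
      | |- GRing.linear_for _ (fun x => GRing.mul (@?f x) ?c) => apply: (@lin_mull _ _ _ f c); lin
      | |- GRing.linear_for _ (fun x => GRing.mul ?c (@?f x)) => apply: (@lin_mulr _ _ _ f c); lin
      | |- GRing.linear_for _ (fun x => GRing.scale ?c (@?f x)) => apply: (@lin_scale _ _ _ c f); lin
      | |- GRing.linear_for _ (fun x => GRing.scale (@?f x) ?v) => apply: (@lin_scalel _ _ _ f v); exact: scalarP
      | |- GRing.linear_for _ (fun x => ?h (@?f x)) => apply: (@lin_comp _ _ _ _ h f); lin
      | |- GRing.linear_for _ (fun x => ?h ?m (@?f x)) => apply: (@lin_bil2 _ _ _ _ _ h f m); [lin|lin]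
      | |- GRing.linear_for _ (fun x => ?h (@?f x) ?n) => apply: (@lin_bil1 _ _ _ _ _ h f n); [lin|lin]
      end
    | progress unfold tmap, tmap2, tassoc; lin ]
  end.

Section TensorMapsTheory.
Context {k : comPzRingType}.
Implicit Types M N P U V : lmodType k.

Lemma tmap_tens M N U V (f : M -> U) (g : N -> V) m n :
  linear f -> linear g -> tmap f g (m ⊗ n) = f m ⊗ g n.
Proof. by move=> fL gL; rewrite /tmap tlift_tens //; lin. Qed.

Lemma tmap_linear M N U V (f : M -> U) (g : N -> V) :
  linear f -> linear g -> linear (tmap f g).
Proof. by move=> fL gL; apply: tlift_linear; lin. Qed.

Lemma tmap2_bilinear M M' M'' N N' N''
    (f : M -> M' -> M'') (g : N -> N' -> N'') :
  bilinear_map f -> bilinear_map g -> bilinear_map (tmap2 f g).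
Proof.
move=> fB gB; split=> [y|x]; rewrite /tmap2.
  by apply: tlift_linear; lin.
by lin.
Qed.

Lemma tmap2_tens M M' M'' N N' N''
    (f : M -> M' -> M'') (g : N -> N' -> N'') m n m' n' :
  bilinear_map f -> bilinear_map g ->
  tmap2 f g (m ⊗ n) (m' ⊗ n') = f m m' ⊗ g n n'.
Proof. by move=> fB gB; rewrite /tmap2 !tlift_tens //; lin. Qed.

Lemma tassoc_linear M N P : linear (@tassoc k M N P).
Proof. by apply: tlift_linear; lin. Qed.

Lemma tassoc_tens M N P (m : M) (n : N) (p : P) :
  tassoc ((m ⊗ n) ⊗ p) = m ⊗ (n ⊗ p).
Proof. by rewrite /tassoc !tlift_tens //; lin. Qed.

Lemma tensor_ext M N P (f g : M ⊗ N -> P) : linear f -> linear g ->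
  (forall m n, f (m ⊗ n) = g (m ⊗ n)) -> forall x, f x = g x.
Proof.
move=> fL gL fg.
apply: (@tensor_ind k M N (fun x => f x = g x)) => [|x y IHx IHy|//].
  by rewrite (linearP0 fL) (linearP0 gL).
by rewrite (linearPD fL) (linearPD gL) IHx IHy.
Qed.

End TensorMapsTheory.


Section TensorMul.
Context {k : comPzRingType}.
Definition tensor_mul (A B : kalgebra k) : A ⊗ B -> A ⊗ B -> A ⊗ B :=
  tmap2 (fun a a' : A => a * a') (fun b b' : B => b * b').
Lemma tensor_mul_bilinear (A B : kalgebra k) : bilinear_map (@tensor_mul A B).
Proof. exact: tmap2_bilinear (mulr_bilinear A) (mulr_bilinear B). Qed.
Lemma tensor_mulE (A B : kalgebra k) (a a' : A) (b b' : B) :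
  tensor_mul (a ⊗ b) (a' ⊗ b') = (a * a') ⊗ (b * b').
Proof. by apply: tmap2_tens; apply: mulr_bilinear. Qed.
End TensorMul.

(* Hopf algebras with bijective antipode: antipodeV is the inverse of antipode. *)
Record hopfAlgebra (k : comPzRingType) := HopfAlgebra {
  hopf_alg :> kalgebra k;
  comul : {linear hopf_alg -> (hopf_alg ⊗ hopf_alg)%type};
  counit : {scalar hopf_alg};
  antipode : {linear hopf_alg -> hopf_alg};
  antipodeV : hopf_alg -> hopf_alg;
  comulA : forall h : hopf_alg,
    tassoc (tmap comul id (comul h)) = tmap id comul (comul h);
  counitl : forall h : hopf_alg,
    tlift (fun x y => counit x *: y) (comul h) = h;
  counitr : forall h : hopf_alg,
    tlift (fun x y => counit y *: x) (comul h) = h;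
  comulM : forall h h' : hopf_alg,
    comul (h * h') = tensor_mul (comul h) (comul h');
  comul1 : comul 1 = (1 : hopf_alg) ⊗ (1 : hopf_alg);
  counitM : forall h h' : hopf_alg, counit (h * h') = counit h * counit h';
  counit1 : counit 1 = 1;
  antipodel : forall h : hopf_alg,
    tlift (fun x y : hopf_alg => antipode x * y) (comul h) = counit h *: (1 : hopf_alg);
  antipoder : forall h : hopf_alg,
    tlift (fun x y : hopf_alg => x * antipode y) (comul h) = counit h *: (1 : hopf_alg);
  antipodeK : cancel antipode antipodeV;
  antipodeVK : cancel antipodeV antipode
}.
Arguments comul {k _}.
Arguments counit {k _}.
Arguments antipode {k _}.
Arguments antipodeV {k _}.

Section Comodules.
Context {k : comPzRingType} (H : hopfAlgebra k).

Definition is_comodule (M : lmodType k) (rho : {linear M -> (M ⊗ H)%type}) : Prop :=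
  (forall m, tassoc (tmap rho id (rho m)) = tmap id comul (rho m)) /\
  (forall m, tlift (fun m' h => counit h *: m') (rho m) = m).

Lemma comodule_coassoc (M P : lmodType k) (rho : {linear M -> (M ⊗ H)%type})
    (f : M -> H -> H -> P) (m : M) :
  is_comodule rho ->
  (forall x y, linear (fun z => f z x y)) ->
  (forall z y, linear (fun x => f z x y)) ->
  (forall z x, linear (fun y => f z x y)) ->
  tlift (fun m' h => tlift (fun x y => f m' x y) (comul h)) (rho m) =
  tlift (fun m' h => tlift (fun n x => f n x h) (rho m')) (rho m).
Proof.
move=> [rhoA _] f1 f2 f3.
pose Phi (t : M ⊗ (H ⊗ H)) := tlift (fun n s => tlift (fun x y => f n x y) s) t.
have fB n : bilinear_map (fun x y => f n x y) by split.
have PhiB : bilinear_map (fun n s => tlift (fun x y => f n x y) s) by lin.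
have PhiL : linear Phi by apply: tlift_linear.
have compR t : Phi (tmap id comul t) =
    tlift (fun n h => tlift (fun x y => f n x y) (comul h)) t.
  rewrite /tmap (tlift_comp _ _ PhiL); apply: eq_tlift => n h.
  by rewrite /Phi tlift_tens.
rewrite -compR -rhoA /tmap (tlift_comp _ _ (@tassoc_linear _ _ _ _)).
rewrite (tlift_comp _ _ PhiL); apply: eq_tlift => n h.
rewrite /tassoc tlift_tens; last by lin.
rewrite (tlift_comp _ _ PhiL); apply: eq_tlift => n' x.
by rewrite /Phi !tlift_tens.
Qed.

Lemma comul_comodule : is_comodule (@comul k H).
Proof. by split; [apply: comulA|apply: counitr]. Qed.

Lemma tlift_mulr (M N : lmodType k) (A : kalgebra k) (f : M -> N -> A)
    (c : A) (t : M ⊗ N) :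
  tlift f t * c = tlift (fun m n => f m n * c) t.
Proof.
exact: (tlift_comp f t (lin_mull c (@lin_id _ _))).
Qed.
Lemma tlift_mull (M N : lmodType k) (A : kalgebra k) (f : M -> N -> A)
    (c : A) (t : M ⊗ N) :
  c * tlift f t = tlift (fun m n => c * f m n) t.
Proof.
exact: (tlift_comp f t (lin_mulr c (@lin_id _ _))).
Qed.

Lemma antipodeM (x y : H) : antipode (x * y) = antipode y * antipode x.
Proof.
pose G (a c d p r s : H) := antipode (a * p) * (c * r * (antipode s * antipode d)).
pose E := tlift (fun a b => tlift (fun c d => tlift (fun p q =>
  tlift (fun r s => G a c d p r s) (comul q)) (comul y)) (comul b)) (comul x).
transitivity E.
  rewrite -[in LHS](counitr x) -[in LHS](counitr y).
  rewrite tlift_mulr (tlift_comp _ _ (linearP antipode)); apply: eq_tlift => a b.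
  rewrite tlift_exchange tlift_mull (tlift_comp _ _ (linearP antipode)).
  apply: eq_tlift => p q.
  transitivity (antipode (a * p) * (counit q *: (counit b *: (1 : H)))).
    rewrite -!(@kscalerAl k H).
    rewrite -!kscalerAr !linearZ /= mulr1.
    by rewrite !scalerA mulrC.
  rewrite -antipoder (tlift_comp _ _ (@lin_scale _ _ _ (counit q) _ (@lin_id _ H))).
  rewrite tlift_mull; apply: eq_tlift => c d.
  rewrite (_ : counit q *: (c * antipode d) = c * (counit q *: (1 : H)) * antipode d); last first.
    by rewrite -kscalerAr mulr1 -kscalerAl.
  rewrite -antipoder tlift_mull tlift_mulr tlift_mull; apply: eq_tlift => r s.
  by rewrite /G !mulrA.
rewrite /E comodule_coassoc; [|exact: comul_comodule|by rewrite /G; lin..].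
transitivity (tlift (fun a b => tlift (fun c d => tlift (fun p q =>
  tlift (fun r s => G c d b r s q) (comul p)) (comul y)) (comul a)) (comul x)).
  apply: eq_tlift => a b; apply: eq_tlift => c d.
  rewrite comodule_coassoc //; [exact: comul_comodule|by rewrite /G; lin..].
transitivity (tlift (fun a b : H => tlift (fun p q : H =>
   counit (a * p) *: (antipode q * antipode b)) (comul y)) (comul x)).
  apply: eq_tlift => a b; rewrite tlift_exchange; apply: eq_tlift => p q.
  rewrite -[X in _ = _ *: X]mul1r kscalerAl -antipodel comulM /tensor_mul.
  pose m3 (t : H ⊗ H) := tlift (fun x y : H => antipode x * y) t.
  have m3L : linear m3 by apply: tlift_linear; lin.
  rewrite /tmap2 -/(m3 _) (tlift_comp _ _ m3L) tlift_mulr.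
  apply: eq_tlift => c d; rewrite (tlift_comp _ _ m3L) tlift_mulr.
  apply: eq_tlift => r s; rewrite /m3 tlift_tens; last by lin.
  by rewrite /G !mulrA.
rewrite -[in RHS](counitl x).
rewrite [in RHS](tlift_comp _ _ (linearP antipode)) tlift_mull.
apply: eq_tlift => a b; rewrite -[in RHS](counitl y).
rewrite [in RHS](tlift_comp _ _ (linearP antipode)) tlift_mulr.
apply: eq_tlift => p q.
by rewrite counitM !linearZ /= -kscalerAl -kscalerAr scalerA mulrC.
Qed.

Lemma antipode1 : antipode (1 : H) = 1.
Proof.
have := antipodel (1 : H).
by rewrite comul1 tlift_tens ?mulr1 ?counit1 ?scale1r //; lin.
Qed.

Lemma antipodeV_linear : linear (@antipodeV k H).
Proof.
move=> a x y; apply: (can_inj (@antipodeK k H)).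
by rewrite linearP !antipodeVK.
Qed.
Lemma antipodeVM (x y : H) : antipodeV (x * y) = antipodeV y * antipodeV x.
Proof.
apply: (can_inj (@antipodeK k H)).
by rewrite antipodeM !antipodeVK.
Qed.
Lemma antipodeV1 : antipodeV (1 : H) = 1.
Proof. by rewrite -antipode1 antipodeK antipode1. Qed.
Lemma antipodeVl (h : H) :
  tlift (fun x y : H => antipodeV y * x) (comul h) = counit h *: (1 : H).
Proof.
apply: (can_inj (@antipodeK k H)).
rewrite (tlift_comp _ _ (linearP antipode)) linearZ /= antipode1 -antipodel.
by apply: eq_tlift => x y; rewrite antipodeM antipodeVK.
Qed.

End Comodules.

Record comodAlgebra (k : comPzRingType) (H : hopfAlgebra k) := ComodAlgebra {
  ca_alg :> kalgebra k;
  ca_coact : {linear ca_alg -> (ca_alg ⊗ H)%type};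
  ca_comodule : is_comodule ca_coact;
  ca_coactM : forall a b : ca_alg,
    ca_coact (a * b) = tensor_mul (ca_coact a) (ca_coact b);
  ca_coact1 : ca_coact 1 = (1 : ca_alg) ⊗ (1 : H)
}.
Arguments ca_coact {k H c}.

Section HopfModules.
Context {k : comPzRingType} {H : hopfAlgebra k}.

Definition is_left_module (A : kalgebra k) (M : lmodType k)
    (act : A -> M -> M) : Prop :=
  [/\ bilinear_map act, forall m, act 1 m = m
    & forall a b m, act (a * b) m = act a (act b m)].

Definition is_right_module (B : kalgebra k) (M : lmodType k)
    (act : M -> B -> M) : Prop :=
  [/\ bilinear_map act, forall m, act m 1 = m
    & forall m a b, act m (a * b) = act (act m a) b].

(* M in _A M^H *)
Record hopfModule (A : comodAlgebra H) (M : lmodType k) := HopfModule {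
  hm_lact : A -> M -> M;
  hm_coact : {linear M -> (M ⊗ H)%type};
  hm_lmodule : is_left_module hm_lact;
  hm_comodule : is_comodule hm_coact;
  hm_coactl : forall a m, hm_coact (hm_lact a m) =
    tmap2 hm_lact (fun h h' : H => h * h') (ca_coact a) (hm_coact m)
}.

(* M in _A M_B^H *)
Record hopfBimodule (A B : comodAlgebra H) (M : lmodType k) := HopfBimodule {
  hb_module :> hopfModule A M;
  hb_ract : M -> B -> M;
  hb_rmodule : is_right_module hb_ract;
  hb_bimodule : forall a m b,
    hb_ract (hm_lact hb_module a m) b = hm_lact hb_module a (hb_ract m b);
  hb_coact : forall a m b,
    hm_coact hb_module (hb_ract (hm_lact hb_module a m) b) =
    tmap2 hb_ract (fun h h' : H => h * h')
      (tmap2 (hm_lact hb_module) (fun h h' : H => h * h')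
        (ca_coact a) (hm_coact hb_module m))
      (ca_coact b)
}.

Section Coinvariants.
Context {M : lmodType k} (rho : {linear M -> (M ⊗ H)%type}).

Definition coinvariant : {pred M} := fun m => `[< rho m = m ⊗ (1 : H) >].

Record coinv := Coinv { coinv_val : M; coinv_valP : coinv_val \in coinvariant }.

HB.instance Definition _ := [isSub for coinv_val].
HB.instance Definition _ := [Choice of coinv by <:].

Lemma coinvP (m : M) : reflect (rho m = m ⊗ (1 : H)) (m \in coinvariant).
Proof. exact: asboolP. Qed.

Fact coinv_zmod : zmod_closed coinvariant.
Proof.
split=> [|x y]; first by apply/coinvP; rewrite linear0 tens0l.
move=> /coinvP xP /coinvP yP; apply/coinvP.
by rewrite linearB /= xP yP tensBl.
Qed.
HB.instance Definition _ :=
  GRing.SubChoice_isSubZmodule.Build M coinvariant coinv coinv_zmod.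
End Coinvariants.

End HopfModules.

Section CoinvariantRing.
Context {k : comPzRingType} {H : hopfAlgebra k}.

Section Ring.
Variable A : comodAlgebra H.

(* A^{co H} *)
Definition coinvA : Type := coinv (@ca_coact k H A).
HB.instance Definition _ := GRing.Zmodule.on coinvA.

Fact coinvA_1 : 1 \in coinvariant (@ca_coact k H A).
Proof. by apply/coinvP; rewrite ca_coact1. Qed.
Fact coinvA_M (u v : coinvA) :
  coinv_val u * coinv_val v \in coinvariant (@ca_coact k H A).
Proof.
case: u v => [x /coinvP xP] [y /coinvP yP] /=; apply/coinvP.
by rewrite ca_coactM xP yP tensor_mulE mulr1.
Qed.
Definition coinvA_one : coinvA := Coinv coinvA_1.
Definition coinvA_mul (u v : coinvA) : coinvA := Coinv (coinvA_M u v).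

Fact coinvA_mulA : associative coinvA_mul.
Proof. by move=> u v w; apply: val_inj; rewrite /= mulrA. Qed.
Fact coinvA_mul1 : left_id coinvA_one coinvA_mul.
Proof. by move=> u; apply: val_inj; rewrite /= mul1r. Qed.
Fact coinvA_mulr1 : right_id coinvA_one coinvA_mul.
Proof. by move=> u; apply: val_inj; rewrite /= mulr1. Qed.
Fact coinvA_mulDl : left_distributive coinvA_mul +%R.
Proof. by move=> u v w; apply: val_inj; rewrite /= mulrDl. Qed.
Fact coinvA_mulDr : right_distributive coinvA_mul +%R.
Proof. by move=> u v w; apply: val_inj; rewrite /= mulrDr. Qed.
HB.instance Definition _ := GRing.Zmodule_isPzRing.Build coinvA
  coinvA_mulA coinvA_mul1 coinvA_mulr1 coinvA_mulDl coinvA_mulDr.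
End Ring.

Section Module.
Context {A : comodAlgebra H} {M : lmodType k} (sM : hopfModule A M).

(* M^{co H}, as a left A^{co H}-module *)
Definition coinvM : Type := coinv (hm_coact sM).
HB.instance Definition _ := GRing.Zmodule.on coinvM.

Fact coinvM_scale_coinv (a : coinvA A) (m : coinvM) :
  hm_lact sM (coinv_val a) (coinv_val m) \in coinvariant (hm_coact sM).
Proof.
case: a m => [a /coinvP aP] [m /coinvP mP] /=; apply/coinvP.
have [actB _ _] := hm_lmodule sM.
rewrite hm_coactl aP mP tmap2_tens ?mulr1 //; exact: mulr_bilinear.
Qed.
Definition coinvM_scale (a : coinvA A) (m : coinvM) : coinvM :=
  Coinv (coinvM_scale_coinv a m).

Fact coinvM_scaleA a b m :
  coinvM_scale a (coinvM_scale b m) = coinvM_scale (a * b) m.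
Proof.
by apply: val_inj => /=; have [_ _ ->] := hm_lmodule sM.
Qed.
Fact coinvM_scale1 : left_id 1 coinvM_scale.
Proof. by move=> m; apply: val_inj => /=; have [_ -> _] := hm_lmodule sM. Qed.
Fact coinvM_scaleDr : right_distributive coinvM_scale +%R.
Proof.
move=> a m m'; apply: val_inj => /=; have [[_ actr] _ _] := hm_lmodule sM.
exact: (linearPD (actr _)).
Qed.
Fact coinvM_scaleDl m : {morph coinvM_scale^~ m : a b / a + b}.
Proof.
move=> a b; apply: val_inj => /=; have [[actl _] _ _] := hm_lmodule sM.
exact: (linearPD (actl _)).
Qed.
HB.instance Definition _ := GRing.Zmodule_isLmodule.Build (coinvA A) coinvM
  coinvM_scaleA coinvM_scale1 coinvM_scaleDr coinvM_scaleDl.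
End Module.
End CoinvariantRing.

Section Cotensor.
Context {k : comPzRingType} {H : hopfAlgebra k} (B C : comodAlgebra H).

(* The ring B ⊗ C^op *)
Definition tensop : Type := (B ⊗ C)%type.
HB.instance Definition _ := GRing.Lmodule.on tensop.

Definition tensop_mul : tensop -> tensop -> tensop :=
  tmap2 (fun b b' : B => b * b') (fun c c' : C => c' * c).

Lemma opmul_bilinear (A : kalgebra k) : bilinear_map (fun x y : A => y * x).
Proof. by split; lin. Qed.
Lemma tensop_mul_bilinear : bilinear_map (tensop_mul : B ⊗ C -> B ⊗ C -> B ⊗ C).
Proof. exact: tmap2_bilinear (mulr_bilinear B) (opmul_bilinear C). Qed.
Lemma tensop_mulE (b b' : B) (c c' : C) :
  tensop_mul (b ⊗ c) (b' ⊗ c') = (b * b') ⊗ (c' * c).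
Proof. exact: tmap2_tens (mulr_bilinear B) (opmul_bilinear C). Qed.

Fact tensop_mulA : associative tensop_mul.
Proof.
have [mulL mulR] := tensop_mul_bilinear.
move=> x y z; move: x; apply: (@tensor_ext k B C (B ⊗ C)%type) => [||b c].
- exact: mulL.
- exact: (lin_comp (mulL z) (mulL y)).
move: y; apply: (@tensor_ext k B C (B ⊗ C)%type) => [||b' c'].
- exact: (lin_comp (mulR _) (mulL z)).
- exact: (lin_comp (mulL z) (mulR _)).
move: z; apply: (@tensor_ext k B C (B ⊗ C)%type) => [||b'' c''].
- exact: (lin_comp (mulR _) (mulR _)).
- exact: mulR.
by rewrite !tensop_mulE !mulrA.
Qed.
Fact tensop_mul1 : left_id ((1 : B) ⊗ (1 : C)) tensop_mul.
Proof.
have [mulL mulR] := tensop_mul_bilinear.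
apply: (@tensor_ext k B C (B ⊗ C)%type) => [||b c]; [exact: mulR|exact: lin_id|].
by rewrite tensop_mulE mul1r mulr1.
Qed.
Fact tensop_mulr1 : right_id ((1 : B) ⊗ (1 : C)) tensop_mul.
Proof.
have [mulL mulR] := tensop_mul_bilinear.
apply: (@tensor_ext k B C (B ⊗ C)%type) => [||b c]; [exact: mulL|exact: lin_id|].
by rewrite tensop_mulE mul1r mulr1.
Qed.
Fact tensop_mulDl : left_distributive tensop_mul +%R.
Proof. by move=> x y z; apply: (linearPD (tensop_mul_bilinear.1 z)). Qed.
Fact tensop_mulDr : right_distributive tensop_mul +%R.
Proof. by move=> x y z; apply: (linearPD (tensop_mul_bilinear.2 x)). Qed.
HB.instance Definition _ := GRing.Zmodule_isPzRing.Build tensop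
  tensop_mulA tensop_mul1 tensop_mulr1 tensop_mulDl tensop_mulDr.

(* The left coaction c |-> S^-1(c_1) ⊗ c_0 of H on C^op *)
Definition op_coact (c : C) : H ⊗ C :=
  tlift (fun (c0 : C) (c1 : H) => antipodeV c1 ⊗ c0) (ca_coact c).

Definition cotensor_pred : {pred tensop} := fun x : B ⊗ C =>
  `[< tassoc (tmap ca_coact id x) = tmap id op_coact x >].

(* The cotensor product of B and C^op over H *)
Record cotensor := Cotensor {
  cotensor_val : tensop;
  cotensor_valP : cotensor_val \in cotensor_pred
}.
HB.instance Definition _ := [isSub for cotensor_val].
HB.instance Definition _ := [Choice of cotensor by <:].

Let Vlin : bilinear_map (fun (c0 : C) (c1 : H) => antipodeV c1 ⊗ c0).
Proof.
split=> [h|c]; first exact: lin_tensr (@lin_id _ _).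
exact: lin_tensl (@antipodeV_linear k H).
Qed.
Lemma op_coact_linear : linear op_coact.
Proof. exact: lin_lift_arg Vlin (linearP ca_coact). Qed.

Lemma cotl_linear : linear (fun x : B ⊗ C => tassoc (tmap ca_coact id x)).
Proof.
apply: (lin_comp (@tassoc_linear _ _ _ _)).
apply: tmap_linear; [exact: linearP|exact: lin_id].
Qed.
Lemma cotr_linear : linear (fun x : B ⊗ C => tmap id op_coact x : B ⊗ (H ⊗ C)).
Proof. by apply: tmap_linear; [exact: lin_id|exact: op_coact_linear]. Qed.

Let opmul (x y : H ⊗ C) : H ⊗ C :=
  tmap2 (fun h h' : H => h * h') (fun c c' : C => c' * c) x y.
Let opmulB : bilinear_map opmul.
Proof. exact: tmap2_bilinear (mulr_bilinear H) (opmul_bilinear C). Qed.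
Let mul3 (x y : B ⊗ (H ⊗ C)) : B ⊗ (H ⊗ C) :=
  tmap2 (fun b b' : B => b * b') opmul x y.
Let mul3B : bilinear_map mul3.
Proof. exact: tmap2_bilinear (mulr_bilinear B) opmulB. Qed.

Let cotlM (x y : tensop) :
  tassoc (tmap ca_coact id (tensop_mul x y)) =
  mul3 (tassoc (tmap ca_coact id x)) (tassoc (tmap ca_coact id y)).
Proof.
have [mulL mulR] := tensop_mul_bilinear.
move: x; apply: (@tensor_ext k B C (B ⊗ (H ⊗ C))%type) => [||b c].
- exact: (lin_comp cotl_linear (mulL y)).
- exact: (lin_comp (mul3B.1 _) cotl_linear).
move: y; apply: (@tensor_ext k B C (B ⊗ (H ⊗ C))%type) => [||b' c'].
- exact: (lin_comp cotl_linear (mulR _)).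
- exact: (lin_comp (mul3B.2 _) cotl_linear).
rewrite tensop_mulE !tmap_tens; try exact: linearP; try exact: lin_id.
rewrite ca_coactM.
pose l (c : C) (t : B ⊗ H) := tassoc (t ⊗ c).
have lL d : linear (l d).
  by apply: (lin_comp (@tassoc_linear _ _ _ _)); apply: lin_tensl; apply: lin_id.
rewrite -![tassoc _]/(l _ _); move: (ca_coact b) (ca_coact b') => t t'.
have [tmL tmR] := @tensor_mul_bilinear k B H.
move: t; apply: (@tensor_ext k B H (B ⊗ (H ⊗ C))%type) => [||b0 b1].
- exact: (lin_comp (lL _) (tmL _)).
- exact: (lin_comp (mul3B.1 _) (lL _)).
move: t'; apply: (@tensor_ext k B H (B ⊗ (H ⊗ C))%type) => [||b0' b1'].
- exact: (lin_comp (lL _) (tmR _)).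
- exact: (lin_comp (mul3B.2 _) (lL _)).
rewrite tensor_mulE /l !tassoc_tens.
rewrite /mul3 tmap2_tens //; last exact: mulr_bilinear.
rewrite /opmul tmap2_tens //; [exact: mulr_bilinear|exact: opmul_bilinear].
Qed.

Let op_coactM (c c' : C) : op_coact (c' * c) = opmul (op_coact c) (op_coact c').
Proof.
rewrite /op_coact ca_coactM; move: (ca_coact c) (ca_coact c') => t t'.
have [tmL tmR] := @tensor_mul_bilinear k C H.
pose L (t : C ⊗ H) := tlift (fun (c0 : C) (c1 : H) => antipodeV c1 ⊗ c0) t.
have LL : linear L by apply: tlift_linear.
rewrite -![tlift _ _]/(L _).
move: t; apply: (@tensor_ext k C H (H ⊗ C)%type) => [||c0 c1].
- exact: (lin_comp LL (tmR _)).
- exact: (lin_comp (opmulB.1 _) LL).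
move: t'; apply: (@tensor_ext k C H (H ⊗ C)%type) => [||c0' c1'].
- exact: (lin_comp LL (tmL _)).
- exact: (lin_comp (opmulB.2 _) LL).
rewrite tensor_mulE /L !tlift_tens // antipodeVM.
by rewrite /opmul tmap2_tens //; [exact: mulr_bilinear|exact: opmul_bilinear].
Qed.

Let cotrM (x y : tensop) :
  tmap id op_coact (tensop_mul x y) =
  mul3 (tmap id op_coact x) (tmap id op_coact y).
Proof.
have [mulL mulR] := tensop_mul_bilinear.
move: x; apply: (@tensor_ext k B C (B ⊗ (H ⊗ C))%type) => [||b c].
- exact: (lin_comp cotr_linear (mulL y)).
- exact: (lin_comp (mul3B.1 _) cotr_linear).
move: y; apply: (@tensor_ext k B C (B ⊗ (H ⊗ C))%type) => [||b' c'].
- exact: (lin_comp cotr_linear (mulR _)).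
- exact: (lin_comp (mul3B.2 _) cotr_linear).
rewrite tensop_mulE !tmap_tens; try exact: op_coact_linear; try exact: lin_id.
rewrite op_coactM /mul3 tmap2_tens //; exact: mulr_bilinear.
Qed.

Fact cotensor_subring : subring_closed cotensor_pred.
Proof.
split=> [|x y /asboolP xP /asboolP yP|x y /asboolP xP /asboolP yP].
- apply/asboolP; rewrite !tmap_tens; try exact: linearP; try exact: lin_id;
    try exact: op_coact_linear.
  rewrite ca_coact1 tassoc_tens /op_coact ca_coact1 tlift_tens //.
  by rewrite antipodeV1.
- apply/asboolP; have /= := cotl_linear (-1) y x; have /= := cotr_linear (-1) y x.
  by rewrite !scaleN1r ![- y + x]addrC => -> ->; rewrite xP yP.
- by apply/asboolP; rewrite [LHS](cotlM x y) [RHS](cotrM x y) xP yP.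
Qed.
HB.instance Definition _ := GRing.SubChoice_isSubPzRing.Build
  tensop cotensor_pred cotensor cotensor_subring.

Lemma cotensorP (x : cotensor) :
  tassoc (tmap ca_coact id (cotensor_val x)) = tmap id op_coact (cotensor_val x).
Proof. exact/asboolP/(cotensor_valP x). Qed.

End Cotensor.

Section BimoduleCoinvariants.
Context {k : comPzRingType} {H : hopfAlgebra k} {B C : comodAlgebra H}.
Context {X : lmodType k} (sX : hopfBimodule B C X).

(* (sum_i b_i ⊗ c_i) . v = sum_i b_i v c_i *)
Definition cot_act (x : tensop B C) (v : X) : X :=
  tlift (fun (b : B) (c : C) => hb_ract sX (hm_lact sX b v) c) x.

Let lactB : bilinear_map (hm_lact sX).
Proof. by have [] := hm_lmodule sX. Qed.
Let ractB : bilinear_map (hb_ract sX).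
Proof. by have [] := hb_rmodule sX. Qed.
Let actB v : bilinear_map (fun (b : B) (c : C) => hb_ract sX (hm_lact sX b v) c).
Proof.
split=> [c|b]; last exact: ractB.2.
exact: (lin_comp (ractB.1 c) (lactB.1 v)).
Qed.

Lemma cot_act_linear v : linear (fun x : B ⊗ C => cot_act x v).
Proof. exact: tlift_linear. Qed.
Lemma cot_act_linear_r (x : tensop B C) : linear (cot_act x).
Proof.
apply: lin_lift_fun => b c.
exact: (lin_comp (ractB.1 c) (lactB.2 b)).
Qed.
Lemma cot_act_tens (b : B) (c : C) v :
  cot_act (b ⊗ c) v = hb_ract sX (hm_lact sX b v) c.
Proof. exact: tlift_tens. Qed.

Lemma cot_act1 v : cot_act 1 v = v.
Proof.
rewrite [LHS]cot_act_tens; have [_ -> _] := hm_lmodule sX.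
by have [_ -> _] := hb_rmodule sX.
Qed.
Lemma cot_actM (x y : tensop B C) v : cot_act (x * y) v = cot_act x (cot_act y v).
Proof.
have [mulL mulR] := tensop_mul_bilinear B C.
move: x; apply: (@tensor_ext k B C X) => [||b c].
- exact: (lin_comp (cot_act_linear v) (mulL y)).
- exact: cot_act_linear.
move: y; apply: (@tensor_ext k B C X) => [||b' c'].
- exact: (lin_comp (cot_act_linear v) (mulR _)).
- exact: (lin_comp (cot_act_linear_r _) (cot_act_linear v)).
rewrite [X in cot_act X v]tensop_mulE !cot_act_tens.
have [_ _ ->] := hm_lmodule sX; have [_ _ ->] := hb_rmodule sX.
by rewrite hb_bimodule.
Qed.

Lemma cot_act_coinv (x : cotensor B C) v :
  v \in coinvariant (hm_coact sX) ->
  cot_act (cotensor_val x) v \in coinvariant (hm_coact sX).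
Proof.
move=> /coinvP vP; apply/coinvP.
pose F (y : X) (c : C) (h : H) :=
  tlift (fun (c0 : C) (c1 : H) => hb_ract sX y c0 ⊗ (h * c1)) (ca_coact c).
have FB y h : bilinear_map (fun (c0 : C) (c1 : H) => hb_ract sX y c0 ⊗ (h * c1)).
  split=> [c1|c0]; first exact: lin_tensl (ractB.2 y).
  exact: lin_tensr (lin_mulr h (@lin_id _ _)).
have F1 c h : linear (fun y => F y c h).
  by apply: lin_lift_fun => c0 c1; apply: lin_tensl; apply: ractB.1.
have F2 y h : linear (fun c => F y c h).
  exact: (lin_lift_arg (FB y h) (linearP ca_coact)).
have F3 y c : linear (fun h => F y c h).
  apply: lin_lift_fun => c0 c1; apply: lin_tensr.
  exact: lin_mull (@lin_id _ _).
pose Psi (u : B ⊗ (H ⊗ C)) := tlift (fun (b : B) (t : H ⊗ C) =>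
  tlift (fun (h : H) (c : C) => F (hm_lact sX b v) c h) t) u.
have FB' b : bilinear_map (fun (h : H) (c : C) => F (hm_lact sX b v) c h).
  by split=> ?; [apply: F3|apply: F2].
have PsiB : bilinear_map (fun (b : B) (t : H ⊗ C) =>
    tlift (fun (h : H) (c : C) => F (hm_lact sX b v) c h) t).
  split=> [t|b]; last exact: tlift_linear.
  apply: lin_lift_fun => h c; exact: (lin_comp (F1 c h) (lactB.1 v)).
have PsiL : linear Psi by apply: tlift_linear.
transitivity (Psi (tassoc (tmap ca_coact id (cotensor_val x)))).
  rewrite /cot_act (tlift_comp _ _ (linearP (hm_coact sX))) /tmap.
  rewrite (tlift_comp _ _ (@tassoc_linear _ _ _ _)) (tlift_comp _ _ PsiL).
  apply: eq_tlift => b c; rewrite hb_coact vP /=.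
  have t2B1 := tmap2_bilinear lactB (mulr_bilinear H).
  have t2B2 := tmap2_bilinear ractB (mulr_bilinear H).
  move: (ca_coact b); apply: (@tensor_ext k B H (X ⊗ H)%type) => [||b0 b1].
  - exact: (lin_comp (t2B2.1 _) (t2B1.1 _)).
  - apply: (lin_comp PsiL); apply: (lin_comp (@tassoc_linear _ _ _ _)).
    exact: lin_tensl (@lin_id _ _).
  rewrite tmap2_tens //; last exact: mulr_bilinear.
  rewrite mulr1 tassoc_tens /Psi !tlift_tens // /tmap2 tlift_tens //.
  split=> [h|y]; first exact: F1.
  exact: F3.
rewrite cotensorP /cot_act /tmap (tlift_comp _ _ PsiL).
rewrite [RHS](tlift_comp (h := fun w => w ⊗ (1 : H))); last first.
  exact: lin_tensl (@lin_id _ _).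
apply: eq_tlift => b c; rewrite /Psi tlift_tens //.
move: (hm_lact sX b v) (FB' b) => y {FB'}FB'.
rewrite /op_coact (tlift_comp _ _ (tlift_linear FB')).
transitivity (tlift (fun (c0 : C) (c1 : H) => F y c0 (antipodeV c1)) (ca_coact c)).
  by apply: eq_tlift => c0 c1; rewrite tlift_tens.
have VL := @antipodeV_linear k H.
rewrite -(comodule_coassoc (f := fun (z : C) (x' y' : H) =>
    hb_ract sX y z ⊗ (antipodeV y' * x'))); first last.
- move=> z x'; apply: lin_tensr; apply: lin_mull; exact: VL.
- by move=> z y'; apply: lin_tensr; apply: lin_mulr; apply: lin_id.
- by move=> x' y'; apply: lin_tensl; apply: ractB.2.
- exact: ca_comodule.
have [_ rho1] := @ca_comodule k H C.
rewrite -[in RHS](rho1 c) [in RHS](tlift_comp _ _ (ractB.2 y)).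
rewrite [in RHS](tlift_comp (h := fun w => w ⊗ (1 : H))); last first.
  exact: lin_tensl (@lin_id _ _).
apply: eq_tlift => c0 h.
rewrite -(tlift_comp (h := fun w => hb_ract sX y c0 ⊗ w)); last first.
  exact: lin_tensr (@lin_id _ _).
by rewrite antipodeVl tensZr (linearPZ (ractB.2 y)) tensZl.
Qed.

(* X^{co H}, as a left module over the cotensor product *)
Definition coinvB : Type := coinv (hm_coact sX).
HB.instance Definition _ := GRing.Zmodule.on coinvB.

Definition coinvB_scale (x : cotensor B C) (v : coinvB) : coinvB :=
  Coinv (cot_act_coinv x (coinv_valP v)).

Fact coinvB_scaleA x y v :
  coinvB_scale x (coinvB_scale y v) = coinvB_scale (x * y) v.
Proof. by apply: val_inj; rewrite /= cot_actM. Qed.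
Fact coinvB_scale1 : left_id 1 coinvB_scale.
Proof. by move=> v; apply: val_inj; rewrite /= cot_act1. Qed.
Fact coinvB_scaleDr : right_distributive coinvB_scale +%R.
Proof.
by move=> x u v; apply: val_inj; apply: (linearPD (cot_act_linear_r _)).
Qed.
Fact coinvB_scaleDl v : {morph coinvB_scale^~ v : x y / x + y}.
Proof.
by move=> x y; apply: val_inj; apply: (linearPD (cot_act_linear _)).
Qed.
HB.instance Definition _ := GRing.Zmodule_isLmodule.Build (cotensor B C) coinvB
  coinvB_scaleA coinvB_scale1 coinvB_scaleDr coinvB_scaleDl.
End BimoduleCoinvariants.

Section HomSpaces.
Context {k : comPzRingType} {H : hopfAlgebra k} {A : comodAlgebra H}.
Context {M N : lmodType k} (sM : hopfModule A M) (sN : hopfModule A N).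

Definition hom_pred : {pred M -> N} := fun f =>
  `[< forall a m m',
        f (hm_lact sM a m + m') = hm_lact sN a (f m) + f m' >].

(* _A Hom(M, N) *)
Record Hom := MkHom { hom_val :> M -> N; hom_valP : hom_val \in hom_pred }.
HB.instance Definition _ := [isSub for hom_val].
HB.instance Definition _ := [Choice of Hom by <:].

Fact hom_submod : submod_closed hom_pred.
Proof.
have [[_ sNr] _ _] := hm_lmodule sN.
have [[sNl _] _ sNM] := hm_lmodule sN.
split=> [|c f g /asboolP fP /asboolP gP]; apply/asboolP => a m m'.
  by rewrite /= (linearP0 (sNr a)) addr0.
rewrite -[LHS]/(c *: f (hm_lact sM a m + m') + g (hm_lact sM a m + m')).
rewrite fP gP scalerDr addrACA.
rewrite -[(c *: f + g) m]/(c *: f m + g m) -[(c *: f + g) m']/(c *: f m' + g m').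
by rewrite sNr.
Qed.
HB.instance Definition _ :=
  GRing.SubChoice_isSubLmodule.Build k (M -> N) hom_pred Hom hom_submod.

(* t = f_0 ⊗ f_1 satisfies
     f_0(m) ⊗ f_1 = f(m_0)_0 ⊗ S^-1(m_1) f(m_0)_1 for all m *)
Definition hom_coact (f : Hom) (t : Hom ⊗ H) : Prop := forall m,
  tlift (fun (g : Hom) (h : H) => g m ⊗ h) t =
  tlift (fun (m0 : M) (m1 : H) =>
    tmap id (fun h : H => antipodeV m1 * h) (hm_coact sN (f m0)))
    (hm_coact sM m).

Definition HOM_pred : {pred Hom} := fun f => `[< exists t, hom_coact f t >].

(* _A HOM(M, N) *)
Record HOM := MkHOM { HOM_val :> Hom; HOM_valP : HOM_val \in HOM_pred }.
HB.instance Definition _ := [isSub for HOM_val].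
HB.instance Definition _ := [Choice of HOM by <:].

Fact HOM_submod : submod_closed HOM_pred.
Proof.
have evB m : bilinear_map (fun (g : Hom) (h : H) => g m ⊗ h).
  split=> [h|g]; last exact: lin_tensr (@lin_id _ _).
  by move=> a g g'; rewrite -tensZl -tensDl.
have tL m1 : linear (tmap (V := H) id (fun h : H => antipodeV m1 * h) : N ⊗ H -> _).
  by apply: tmap_linear; [exact: lin_id|apply: lin_mulr; apply: lin_id].
split=> [|c f g /asboolP[t tP] /asboolP[u uP]]; apply/asboolP.
  exists 0 => m; rewrite (linearP0 (tlift_linear (evB m))).
  rewrite /tlift /blift big1 // => p _.
  by rewrite [X in hm_coact sN X](_ : _ = 0) // linear0 (linearP0 (tL _)).
exists (c *: t + u) => m; rewrite (tlift_linear (evB m)) tP uP.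
rewrite /tlift /blift scaler_sumr -big_split /=; apply: eq_bigr => p _.
rewrite -(tL p.2); congr (tmap _ _ _).
by rewrite -linearP.
Qed.
HB.instance Definition _ :=
  GRing.SubChoice_isSubLmodule.Build k Hom HOM_pred HOM HOM_submod.

End HomSpaces.

(* Hom_R(U, V), for left modules over a possibly noncommutative ring *)
Section LinearMaps.
Context {R : pzRingType} (U V : lmodType R).

Definition linhom_pred : {pred U -> V} := fun f => `[< linear f >].
Record linhom := LinHom {
  linhom_val :> U -> V;
  linhom_valP : linhom_val \in linhom_pred
}.
HB.instance Definition _ := [isSub for linhom_val].
HB.instance Definition _ := [Choice of linhom by <:].

Fact linhom_zmod : zmod_closed linhom_pred.
Proof.
split=> [|f g /asboolP fL /asboolP gL]; apply/asboolP => a x y.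
  by rewrite /= scaler0 addr0.
rewrite -[LHS]/(f (a *: x + y) - g (a *: x + y)) fL gL opprD addrACA -scalerBr.
by [].
Qed.
HB.instance Definition _ :=
  GRing.SubChoice_isSubZmodule.Build (U -> V) linhom_pred linhom linhom_zmod.
End LinearMaps.

Definition projective (R : pzRingType) (P : lmodType R) : Prop :=
  forall (U V : lmodType R) (g : {linear U -> V}) (f : {linear P -> V}),
    (forall v, exists u, g u = v) ->
    exists h : {linear P -> U}, forall x, g (h x) = f x.

Section FaithfullyFlat.

Definition exact_at (U V W : zmodType) (f : U -> V) (g : V -> W) : Prop :=
  forall y, g y = 0 <-> exists x, f x = y.

(* P is a right R-module through act; P ⊗_R - preserves and reflects exactness *)
Definition faithfully_flat_right (R : pzRingType) (P : zmodType)
    (act : P -> R -> P) : Prop :=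
  forall (U V W : lmodType R) (f : {linear U -> V}) (g : {linear V -> W}),
  exact_at f g <->
  exact_at
    (blift (fun p u => btens p (f u)) :
       btensor act (fun (a : R) (u : U) => a *: u) ->
       btensor act (fun (a : R) (v : V) => a *: v))
    (blift (fun p v => btens p (g v)) :
       btensor act (fun (a : R) (v : V) => a *: v) ->
       btensor act (fun (a : R) (w : W) => a *: w)).
End FaithfullyFlat.

Section Galois.
Context {k : comPzRingType} {H : hopfAlgebra k} (A : comodAlgebra H).

Definition coinvA_ract (a : A) (u : coinvA A) : A := a * coinv_val u.
Definition coinvA_lact (u : coinvA A) (a : A) : A := coinv_val u * a.

(* can'(a ⊗ b) = a_0 b ⊗ a_1, on A ⊗_{A^{co H}} A *)
Definition can' (x : btensor coinvA_ract coinvA_lact) : A ⊗ H :=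
  blift (fun a b : A => tmap (fun a0 : A => a0 * b) id (ca_coact a)) x.

Definition right_ff_Galois : Prop :=
  faithfully_flat_right coinvA_ract /\ bijective can'.
End Galois.

Section Extension.
Context {k : comPzRingType} {H : hopfAlgebra k} {A : comodAlgebra H}.
Context {M N : lmodType k} (sM : hopfModule A M) (sN : hopfModule A N).

(* gt is a left A-linear H-colinear map M -> N extending g *)
Definition is_extension (g : linhom (coinvM sM) (coinvM sN)) (gt : M -> N) : Prop :=
  [/\ forall a m m', gt (hm_lact sM a m + m') = hm_lact sN a (gt m) + gt m',
      forall m, hm_coact sN (gt m) = tmap gt id (hm_coact sM m)
    & forall m : coinvM sM, gt (coinv_val m) = coinv_val (g m)].
End Extension.

Definition is_module_action (R : pzRingType) (V : zmodType)
    (act : R -> V -> V) : Prop :=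
  [/\ forall a b v, act (a * b) v = act a (act b v),
      forall v, act 1 v = v,
      forall a b v, act (a + b) v = act a v + act b v
    & forall a u v, act a (u + v) = act a u + act a v].

(* Main.v *)
Require Import Defs.
From HB Require Import structures.
From mathcomp Require Import all_boot all_algebra.
From mathcomp Require Import boolp functions.

Set Implicit Arguments.
Unset Strict Implicit.
Unset Printing Implicit Defensive.
Import GRing.Theory.
Local Open Scope ring_scope.

(** Two facts carry the proof.

    The first is about the coaction on HOM.  The identity that defines it,
      f_0(m) ⊗ f_1 = f(m_0)_0 ⊗ S^-1(m_1) f(m_0)_1,
    is equivalent to the antipode-free identity
      rho(f m) = f_0(m_0) ⊗ m_1 f_1                                 [hom_coactE]
    because F |-> (m |-> m_1 F(m_0)) is an invertible operation on linear maps
    M -> P ⊗ H, with inverse given by S^-1 ([twistK], [untwistK]).  In the second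
    form most of the statement can be read off: it is compatible with the two
    actions because rho(f(mb)c) = f_0(m_0 b_0) c_0 ⊗ m_1 b_1 f_1 c_1, and it says
    that f is coinvariant exactly when f is colinear.  What remains is that
    f_0 ⊗ f_1 is unique, lies in HOM ⊗ H and not just in Hom ⊗ H, and is
    coassociative.  Here H is projective: it has a dual basis, so an element of
    V ⊗ H is determined by, and can be rebuilt from, its slices in V along the
    functionals on H ([tensor_slices], [slice_inj]).  Applying (rho ⊗ id) and
    (id ⊗ Delta) to the antipode-free identity shows that the slice of f_0 ⊗ f_1
    along phi is again an element of HOM, with coaction f_0 ⊗ f_1 phi(f_2)
    ([hom_coact_slice]); that one computation gives both membership in HOM ⊗ H
    and coassociativity.

    The second is faithfully flat descent ([adj_counit_bijective]): when A is a
    right faithfully flat Galois extension of R = A^{co H}, the map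
    A ⊗_R M^{co H} -> M is bijective for every Hopf module M.  Bijectivity of
    can' for A gives an isomorphism A ⊗_R X -> X ⊗ H, a ⊗ x |-> a_0 x ⊗ a_1, for
    every A-module X.
    Tensoring with A the exact sequence 0 -> M^{co H} -> M -> M ⊗ H given by
    rho(m) - m ⊗ 1, and transporting it along these isomorphisms, where A acts
    diagonally on M ⊗ H, turns the last map into
    (rho ⊗ id) - (id ⊗ Delta) : M ⊗ H -> (M ⊗ H) ⊗ H, which vanishes on rho(M) by
    coassociativity.

    Consequently an R-linear map g : M^{co H} -> N^{co H} has exactly one A-linear
    colinear extension, a ⊗ m |-> a g(m).  Since coinvariants of HOM are the
    A-linear colinear maps, restriction is bijective, and the action of the
    cotensor product on the maps g is the transport along it of the action on
    the coinvariants of HOM. *)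

(** * Free modules *)

Section FreeModule.
Context {k : comPzRingType} (T : choiceType).

Definition finsupp_pred : {pred T -> k^o} := fun f =>
  `[< exists s : seq T, forall x, x \notin s -> f x = 0 >].

Record freemod := FreeMod {
  freemod_val :> T -> k^o;
  freemod_valP : freemod_val \in finsupp_pred
}.
HB.instance Definition _ := [isSub for freemod_val].
HB.instance Definition _ := [Choice of freemod by <:].

Fact finsupp_submod : submod_closed finsupp_pred.
Proof.
split=> [|c f g /asboolP[s sP] /asboolP[t tP]]; apply/asboolP.
  by exists [::].
exists (s ++ t) => x; rewrite mem_cat negb_or => /andP[/sP fx /tP gx].
by rewrite -[LHS]/(c *: f x + g x) fx gx scaler0 addr0.
Qed.
HB.instance Definition _ :=
  GRing.SubChoice_isSubLmodule.Build k (T -> k^o) finsupp_pred freemod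
    finsupp_submod.

(** Duplicates are removed so that sums over this list do not depend on the
    list chosen by [cid]. *)
Definition freemod_supp (f : freemod) : seq T :=
  undup (sval (cid (asboolP _ (freemod_valP f)))).

Lemma freemod_suppP (f : freemod) x : x \notin freemod_supp f -> f x = 0.
Proof. by rewrite /freemod_supp mem_undup; case: cid => s /= /[apply]. Qed.

Lemma freemod_supp_uniq (f : freemod) : uniq (freemod_supp f).
Proof. exact: undup_uniq. Qed.

Section Lift.
Context (P : lmodType k) (e : T -> P).

Definition freemod_lift (f : freemod) : P :=
  \sum_(x <- freemod_supp f) f x *: e x.

(** The value does not depend on the chosen support, which is what makes the
    lift additive: two functions can be summed over a common list. *)
Lemma freemod_liftE (f : freemod) s : uniq s ->
  (forall x, x \notin s -> f x = 0) -> freemod_lift f = \sum_(x <- s) f x *: e x.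
Proof.
have nz r : \sum_(x <- r) f x *: e x = \sum_(x <- [seq x <- r | f x != 0]) f x *: e x.
  rewrite big_filter; apply/esym/big_rmcond => x; rewrite negbK => /eqP->.
  by rewrite scale0r.
move=> s_uniq s0; rewrite /freemod_lift nz [RHS]nz; apply: perm_big.
apply: uniq_perm; rewrite ?filter_uniq ?freemod_supp_uniq // => x.
rewrite !mem_filter; case: (eqVneq (f x) 0) => //= fx.
have -> : x \in s by apply/negPn/negP => /s0 f0; rewrite f0 eqxx in fx.
by apply/negPn/negP => /freemod_suppP f0; rewrite f0 eqxx in fx.
Qed.

Fact freemod_lift_linear : linear freemod_lift.
Proof.
move=> c f g; pose s := undup (freemod_supp f ++ freemod_supp g).
have sP x : x \notin s -> f x = 0 /\ g x = 0.
  by rewrite mem_undup mem_cat negb_or => /andP[/freemod_suppP-> /freemod_suppP->].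
rewrite !(@freemod_liftE _ s) ?undup_uniq // => [|x /sP[]//|x /sP[]//|x /sP[]].
  rewrite scaler_sumr -big_split; apply: eq_bigr => x _ /=.
  by rewrite scalerA -scalerDl.
by move=> fx gx; rewrite -[LHS]/(c *: f x + g x) fx gx scaler0 addr0.
Qed.
HB.instance Definition _ :=
  GRing.isLinear.Build k freemod P _ freemod_lift freemod_lift_linear.

Fact delta_finsupp (x : T) : (fun y => (y == x)%:R : k^o) \in finsupp_pred.
Proof.
apply/asboolP; exists [:: x] => y; rewrite inE => /negbTE.
by move=> ->.
Qed.

Lemma freemod_lift_delta x : freemod_lift (FreeMod (delta_finsupp x)) = e x.
Proof.
rewrite (@freemod_liftE _ [:: x]) // => [|y].
  by rewrite big_cons big_nil /= eqxx scale1r addr0.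
by rewrite inE => /negbTE /= ->.
Qed.
End Lift.
End FreeModule.

(** * Slices along functionals on a projective module *)

Section Slices.
Context {k : comPzRingType}.
Implicit Types P V W : lmodType k.

Definition slice V P (phi : P -> k) (t : V ⊗ P) : V :=
  tlift (fun v p => phi p *: v) t.

Lemma slice_bilinear V P (phi : P -> k) : scalar phi ->
  bilinear_map (fun (v : V) (p : P) => phi p *: v).
Proof.
move=> phiL; split=> [p|v]; first exact: lin_scale (@lin_id _ _).
exact: lin_scalel.
Qed.

Lemma slice_linear V P (phi : P -> k) : scalar phi -> linear (@slice V P phi).
Proof. by move=> phiL; apply: tlift_linear; apply: slice_bilinear. Qed.

Lemma slice_tens V P (phi : P -> k) (v : V) (p : P) : scalar phi ->
  slice phi (v ⊗ p) = phi p *: v.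
Proof. by move=> phiL; apply: tlift_tens; apply: slice_bilinear. Qed.

Lemma slice_tmap V W P (f : V -> W) (phi : P -> k) (t : V ⊗ P) :
  linear f -> scalar phi -> slice phi (tmap f id t) = f (slice phi t).
Proof.
move=> fL phiL; move: t; apply: tensor_ext => [||v p].
- apply: (lin_comp (slice_linear phiL)); apply: tmap_linear => //; exact: lin_id.
- exact: (lin_comp fL (slice_linear phiL)).
by rewrite tmap_tens // !slice_tens // (Defs.linearPZ fL).
Qed.

(** A section of the surjection from the free module on the elements of P
    gives a dual basis, whose vectors are the elements of P themselves. *)
Lemma projective_dual_basis P : projective P ->
  exists phi : P -> {scalar P}, forall y : P, exists s : seq P,
  [/\ uniq s, forall x, x \notin s -> phi x y = 0
    & y = \sum_(x <- s) phi x y *: x].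
Proof.
move=> projP; pose g := freemod_lift (@id P) : {linear freemod P -> P}.
have [v|h hK] := projP _ _ g idfun.
  by exists (FreeMod (delta_finsupp v)); exact: freemod_lift_delta.
have phiL x : scalar (fun y => h y x : k).
  by move=> a y z; rewrite linearP.
pose phi x : {scalar P} :=
  HB.pack (fun y => h y x : k) (GRing.isLinear.Build k P k _ _ (phiL x)).
exists phi => y; exists (freemod_supp (h y)); split.
- exact: freemod_supp_uniq.
- by move=> x /freemod_suppP.
- exact/esym/hK.
Qed.

(** The dual basis rebuilds t from slices; the functionals involved depend
    on t, through the supports of its components in P. *)
Lemma tensor_slices P V (t : V ⊗ P) : projective P ->
  exists s : seq ({scalar P} * P), t = \sum_(p <- s) slice p.1 t ⊗ p.2.
Proof.
move=> /projective_dual_basis[phi phiP].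
suff [s [_ _ ts]] : exists s : seq P,
    [/\ uniq s, forall x, x \notin s -> slice (phi x) t = 0
      & t = \sum_(x <- s) slice (phi x) t ⊗ x].
  by exists [seq (phi x, x) | x <- s]; rewrite big_map.
have phiL x : scalar (phi x) by exact: linearP.
have slice0 x : slice (phi x) (0 : V ⊗ P) = 0.
  exact: linearP0 (slice_linear (phiL x)).
(* A tensor can be expanded over any finite list containing its support, so
   that two tensors can be expanded over the same list. *)
have widen (u : V ⊗ P) (s s' : seq P) : uniq s -> uniq s' -> {subset s <= s'} ->
    (forall x, x \notin s -> slice (phi x) u = 0) ->
    \sum_(x <- s) slice (phi x) u ⊗ x = \sum_(x <- s') slice (phi x) u ⊗ x.
  move=> us us' ss' u0; rewrite [RHS](bigID (mem s)) /= [X in _ + X]big1.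
    rewrite addr0 -[RHS]big_filter; apply: perm_big; apply: uniq_perm => //.
      exact: filter_uniq.
    by move=> x; rewrite mem_filter; case: (boolP (x \in s)) => //= /ss'->.
  by move=> x /u0->; rewrite tens0l.
move: t; apply: tensor_ind => [|t u [s [us s0 tE]] [s' [us' s0' uE]]|v p].
- by exists [::]; split=> //; rewrite big_nil.
- pose r := undup (s ++ s'); have ur : uniq r by exact: undup_uniq.
  have sr : {subset s <= r} by move=> x; rewrite mem_undup mem_cat => ->.
  have sr' : {subset s' <= r}.
    by move=> x; rewrite mem_undup mem_cat orbC => ->.
  have sliceD x : slice (phi x) (t + u) = slice (phi x) t + slice (phi x) u.
    exact: linearPD (slice_linear (phiL x)) t u.
  exists r; split=> // [x xr|].
    by rewrite sliceD s0 ?s0' ?addr0 //; apply: contra xr; [apply: sr'|apply: sr].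
  rewrite {1}tE {1}uE (widen t s r) // (widen u s' r) // -big_split.
  by apply: eq_bigr => x _; rewrite sliceD tensDl.
have [s [us s0 pE]] := phiP p; exists s; split=> // [x xs|].
  by rewrite slice_tens // s0 // scale0r.
rewrite {1}pE; transitivity (\sum_(x <- s) v ⊗ (phi x p *: x)).
  elim/big_rec2: _ => [|x y z _ <-]; last by rewrite tensDr.
  exact: linearP0 (lin_tensr v (@lin_id _ P)).
by apply: eq_bigr => x _; rewrite slice_tens // tensZ.
Qed.

(** Equalities in V ⊗ P can be tested on functionals; every uniqueness and
    coassociativity statement for the coaction on HOM uses this. *)
Lemma slice_inj P V (t u : V ⊗ P) : projective P ->
  (forall phi : {scalar P}, slice phi t = slice phi u) -> t = u.
Proof.
move=> projP tu; apply/eqP; rewrite -subr_eq0; apply/eqP.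
have [s ->] := tensor_slices (t - u) projP; rewrite big1 // => p _.
have pL : scalar p.1 by exact: linearP.
suff -> : slice p.1 (t - u) = 0 by rewrite tens0l.
have := slice_linear pL (-1) u t (V := V).
by rewrite !scaleN1r ![- u + t]addrC => ->; rewrite tu addNr.
Qed.

Lemma tmap_inj P V W (f : V -> W) : projective P -> linear f -> injective f ->
  injective (tmap f id : V ⊗ P -> W ⊗ P).
Proof.
move=> projP fL f_inj t u tu; apply: slice_inj => // phi; apply: f_inj.
by rewrite -!slice_tmap ?tu //; exact: linearP.
Qed.
End Slices.

(** * Twisting by the coaction *)

Section Legs.
Context {k : comPzRingType} {H : hopfAlgebra k}.
Implicit Types P V W : lmodType k.

(** With [antipodeVl], this says that S^-1 is an antipode for the opposite
    multiplication. *)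
Lemma antipodeVr (h : H) :
  tlift (fun x y : H => y * antipodeV x) (comul h) = counit h *: (1 : H).
Proof.
apply: (can_inj (@antipodeK k H)).
rewrite (tlift_comp _ _ (linearP antipode)) linearZ /= antipode1 -antipoder.
by apply: eq_tlift => x y; rewrite antipodeM antipodeVK.
Qed.

Definition lmulH P (h : H) (x : P ⊗ H) : P ⊗ H := tmap id (fun h' : H => h * h') x.

Lemma lmulH_bilinear P : bilinear_map (@lmulH P).
Proof.
split=> [x|h].
  by apply: lin_lift_fun => p h; apply: lin_tensr; apply: lin_mull; apply: lin_id.
by apply: tmap_linear; [exact: lin_id|apply: lin_mulr; exact: lin_id].
Qed.

Lemma lmulH_tens P (h h' : H) (p : P) : lmulH h (p ⊗ h') = p ⊗ (h * h').
Proof. by apply: tmap_tens; [exact: lin_id|apply: lin_mulr; exact: lin_id]. Qed.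

Lemma lmulHA P (h h' : H) (x : P ⊗ H) : lmulH h (lmulH h' x) = lmulH (h * h') x.
Proof.
have lL c := (@lmulH_bilinear P).2 c.
move: x; apply: tensor_ext => [||p c]; [exact: lin_comp|exact: lL|].
by rewrite !lmulH_tens mulrA.
Qed.

Lemma lmulHZ P a (h : H) (x : P ⊗ H) : lmulH (a *: h) x = a *: lmulH h x.
Proof. exact: (Defs.linearPZ ((@lmulH_bilinear P).1 x)). Qed.

Lemma lmulH1 P (x : P ⊗ H) : lmulH 1 x = x.
Proof.
move: x; apply: tensor_ext => [||p c]; [exact: (lmulH_bilinear P).2|exact: lin_id|].
by rewrite lmulH_tens mul1r.
Qed.

Lemma lmulH_tmap P V (f : P -> V) (h : H) (x : P ⊗ H) : linear f ->
  tmap f id (lmulH h x) = lmulH h (tmap f id x).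
Proof.
move=> fL; have fiL := tmap_linear fL (@lin_id _ H).
have lL W c := (@lmulH_bilinear W).2 c.
move: x; apply: tensor_ext => [||p c]; [exact: lin_comp|exact: lin_comp|].
by rewrite tmap_tens // !lmulH_tens tmap_tens //; exact: lin_id.
Qed.

Section Twist.
Context {M : lmodType k} (rho : {linear M -> (M ⊗ H)%type}).
Hypothesis rhoC : is_comodule rho.
Variable (P : lmodType k).
Implicit Types F G : M -> (P ⊗ H)%type.

Definition twist F (m : M) : P ⊗ H :=
  tlift (fun (m0 : M) (m1 : H) => lmulH m1 (F m0)) (rho m).

Definition untwist F (m : M) : P ⊗ H :=
  tlift (fun (m0 : M) (m1 : H) => lmulH (antipodeV m1) (F m0)) (rho m).

Let lB := @lmulH_bilinear P.
Let VL := @antipodeV_linear k H.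

Let counit_collapse F m : linear F ->
  tlift (fun m0 m1 => lmulH (counit m1 *: (1 : H)) (F m0)) (rho m) = F m.
Proof.
move=> FL; rewrite -[in RHS](rhoC.2 m) (tlift_comp _ _ FL); apply: eq_tlift => m0 m1.
by rewrite lmulHZ lmulH1 (Defs.linearPZ FL).
Qed.

(** m_2 and m_1 are adjacent here, and S^-1(m_2) m_1 collapses to the
    counit. *)
Lemma twistK F : linear F -> untwist (twist F) =1 F.
Proof.
move=> FL m; rewrite -[RHS](counit_collapse _ FL) /untwist /twist.
transitivity (tlift (fun (m0 : M) (m1 : H) => tlift (fun (m00 : M) (m01 : H) =>
    lmulH (antipodeV m1 * m01) (F m00)) (rho m0)) (rho m)).
  apply: eq_tlift => m0 m1; rewrite (tlift_comp _ _ (lB.2 _)).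
  by apply: eq_tlift => m00 m01; rewrite lmulHA.
rewrite -(comodule_coassoc (f := fun (z : M) (x y : H) => lmulH (antipodeV y * x) (F z))) //.
- apply: eq_tlift => m0 h; rewrite -antipodeVl.
  exact/esym/(tlift_comp _ _ (lB.1 (F m0))).
- by lin.
- by lin.
- by lin.
Qed.

Lemma untwistK F : linear F -> twist (untwist F) =1 F.
Proof.
move=> FL m; rewrite -[RHS](counit_collapse _ FL) /untwist /twist.
transitivity (tlift (fun (m0 : M) (m1 : H) => tlift (fun (m00 : M) (m01 : H) =>
    lmulH (m1 * antipodeV m01) (F m00)) (rho m0)) (rho m)).
  apply: eq_tlift => m0 m1; rewrite (tlift_comp _ _ (lB.2 _)).
  by apply: eq_tlift => m00 m01; rewrite lmulHA.
rewrite -(comodule_coassoc (f := fun (z : M) (x y : H) => lmulH (y * antipodeV x) (F z))) //.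
- apply: eq_tlift => m0 h; rewrite -antipodeVr.
  exact/esym/(tlift_comp _ _ (lB.1 (F m0))).
- by lin.
- by lin.
- by lin.
Qed.

Lemma eq_twist F G : F =1 G -> twist F =1 twist G.
Proof. by move=> FG m; apply: eq_tlift => m0 m1; rewrite FG. Qed.

Lemma eq_untwist F G : F =1 G -> untwist F =1 untwist G.
Proof. by move=> FG m; apply: eq_tlift => m0 m1; rewrite FG. Qed.

(** Twisting cancels: an identity of maps into P ⊗ H may be checked after
    multiplication by m_1. *)
Lemma twist_inj F G : linear F -> linear G -> twist F =1 twist G -> F =1 G.
Proof. by move=> FL GL FG m; rewrite -(twistK FL) (eq_untwist FG) twistK. Qed.
End Twist.

Definition tassocV V W P (x : V ⊗ (W ⊗ P)) : (V ⊗ W) ⊗ P :=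
  tlift (fun v t => tlift (fun w p => (v ⊗ w) ⊗ p) t) x.

Lemma tassocV_linear V W P : linear (@tassocV V W P).
Proof. by apply: tlift_linear; lin. Qed.

Lemma tassocV_tens V W P (v : V) (w : W) (p : P) :
  tassocV (v ⊗ (w ⊗ p)) = (v ⊗ w) ⊗ p.
Proof. by rewrite /tassocV !tlift_tens //; lin. Qed.

Lemma tassocK V W P : cancel (@tassoc k V W P) (@tassocV V W P).
Proof.
have aL := @tassoc_linear k V W P; have vL := @tassocV_linear V W P.
apply: tensor_ext => [||t p]; [exact: lin_comp|exact: lin_id|].
move: t; apply: tensor_ext => [||v w].
- by apply: (lin_comp vL); apply: (lin_comp aL); apply: lin_tensl; apply: lin_id.
- by apply: lin_tensl; apply: lin_id.
by rewrite tassoc_tens tassocV_tens.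
Qed.

Lemma tassocVK V W P : cancel (@tassocV V W P) (@tassoc k V W P).
Proof.
have aL := @tassoc_linear k V W P; have vL := @tassocV_linear V W P.
apply: tensor_ext => [||v t]; [exact: lin_comp|exact: lin_id|].
move: t; apply: tensor_ext => [||w p].
- by apply: (lin_comp aL); apply: (lin_comp vL); apply: lin_tensr; apply: lin_id.
- by apply: lin_tensr; apply: lin_id.
by rewrite tassocV_tens tassoc_tens.
Qed.

(** id ⊗ Delta, bracketed so that slicing removes the last factor. *)
Definition comul_leg V (x : V ⊗ H) : (V ⊗ H) ⊗ H := tassocV (tmap id comul x).

Lemma comul_leg_linear V : linear (@comul_leg V).
Proof.
apply: lin_comp; first exact: tassocV_linear.
by apply: tmap_linear; [exact: lin_id|exact: linearP].
Qed.

Lemma comul_leg_tens V (v : V) (h : H) :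
  comul_leg (v ⊗ h) = tlift (fun h1 h2 => (v ⊗ h1) ⊗ h2) (comul h).
Proof.
rewrite /comul_leg tmap_tens; [|exact: lin_id|exact: linearP].
by rewrite /tassocV tlift_tens //; lin.
Qed.

Lemma comul_leg_tmap V W (f : V -> W) (x : V ⊗ H) : linear f ->
  comul_leg (tmap f id x) = tmap (tmap f id) id (comul_leg x).
Proof.
move=> fL; have fiL := tmap_linear fL (@lin_id _ H).
have fiiL := tmap_linear fiL (@lin_id _ H).
move: x; apply: tensor_ext => [||v h].
- exact: (lin_comp (@comul_leg_linear W) fiL).
- exact: (lin_comp fiiL (@comul_leg_linear V)).
rewrite tmap_tens // !comul_leg_tens (tlift_comp _ _ fiiL); apply: eq_tlift => h1 h2.
by rewrite !tmap_tens //; exact: lin_id.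
Qed.

Lemma comul_leg_lmulH V (h : H) (x : V ⊗ H) : comul_leg (lmulH h x) =
  tlift (fun a b : H => lmulH b (tmap (lmulH a) id (comul_leg x))) (comul h).
Proof.
have lB W := @lmulH_bilinear W; have dL := @comul_leg_linear V.
have lL a := (lB V).2 a.
have lL2 a := (lB (V ⊗ H)%type).2 a.
have liL a : linear (tmap (lmulH a) id : (V ⊗ H) ⊗ H -> (V ⊗ H) ⊗ H).
  by apply: tmap_linear; [exact: lL|exact: lin_id].
move: x; apply: tensor_ext => [||v c]; first exact: lin_comp.
  apply: lin_lift_fun => a b; apply: (lin_comp (lL2 b)); exact: (lin_comp (liL a)).
rewrite lmulH_tens !comul_leg_tens comulM.
pose D (t : H ⊗ H) := tlift (fun h1 h2 => (v ⊗ h1) ⊗ h2) t.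
have DB : bilinear_map (fun h1 h2 : H => (v ⊗ h1) ⊗ h2) by lin.
have DL : linear D by apply: tlift_linear.
rewrite -/(D _) /tensor_mul /tmap2 (tlift_comp _ _ DL); apply: eq_tlift => a b.
rewrite (tlift_comp _ _ DL) (tlift_comp _ _ (liL a)) (tlift_comp _ _ (lL2 b)).
apply: eq_tlift => h1 h2; rewrite /D tlift_tens //.
rewrite tmap_tens; [|exact: lL|exact: lin_id].
by rewrite !lmulH_tens.
Qed.

Lemma comodule_comul_leg V (rho : {linear V -> (V ⊗ H)%type}) (v : V) :
  is_comodule rho -> tmap rho id (rho v) = comul_leg (rho v).
Proof.
case=> rhoA _; rewrite -[LHS](@tassocK V H H).
by congr (tassocV _); exact: rhoA.
Qed.
End Legs.

(** * The coaction on HOM *)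

Section HomCoaction.
Context {k : comPzRingType} {H : hopfAlgebra k} {A : comodAlgebra H}.
Context {M N : lmodType k} (sM : hopfModule A M) (sN : hopfModule A N).
Hypothesis projH : projective H.
Local Notation Hom := (Defs.Hom sM sN).
Local Notation HOM := (HOM sM sN).

Lemma hom_lact (f : Hom) a m m' :
  f (hm_lact sM a m + m') = hm_lact sN a (f m) + f m'.
Proof. exact: (asboolP _ (hom_valP f)). Qed.

Lemma module_actZ (Q : lmodType k) (sQ : hopfModule A Q) c (q : Q) :
  hm_lact sQ (c *: (1 : A)) q = c *: q.
Proof.
have [[aL _] a1 _] := hm_lmodule sQ.
by rewrite (Defs.linearPZ (aL q)) a1.
Qed.

Lemma hom_linear (f : Hom) : linear f.
Proof. by move=> c m m'; rewrite -(module_actZ sM) hom_lact module_actZ. Qed.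

Definition eval_at (m : M) (f : Hom) : N := f m.

Lemma eval_at_linear m : linear (eval_at m).
Proof. by []. Qed.

Definition eval_coeff (t : Hom ⊗ H) (m : M) : N ⊗ H := tmap (eval_at m) id t.

Lemma eval_coeff_linear t : linear (eval_coeff t).
Proof. by apply: lin_lift_fun => f h; apply: lin_tensl; exact: hom_linear. Qed.

Lemma eval_coeff_linear_l m : linear (eval_coeff^~ m).
Proof. by apply: tmap_linear; [exact: eval_at_linear|exact: lin_id]. Qed.

(** The defining identity of f_0 ⊗ f_1 says that its evaluation is the untwist
    of rho o f; twisting both sides removes the antipode. *)
Lemma hom_coactE (f : Hom) t :
  hom_coact f t <-> (forall m, hm_coact sN (f m) = twist (hm_coact sM) (eval_coeff t) m).
Proof.
have rfL : linear (fun m => hm_coact sN (f m)).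
  exact: (lin_comp (linearP _) (hom_linear f)).
have ftE : hom_coact f t <->
    eval_coeff t =1 untwist (hm_coact sM) (fun m => hm_coact sN (f m)) by [].
rewrite ftE; split=> ft m.
  by rewrite (eq_twist _ ft) untwistK //; exact: hm_comodule.
by rewrite (eq_untwist _ ft) twistK //; [exact: hm_comodule|exact: eval_coeff_linear].
Qed.

(** Slices of f_0 ⊗ f_1 are maps, hence determined by their values, and these
    values are slices of the right-hand side of the defining identity. *)
Lemma hom_coact_inj (f : Hom) t u : hom_coact f t -> hom_coact f u -> t = u.
Proof.
move=> ft fu; apply: slice_inj => // phi; apply: val_inj; apply/funext => m.
have phiL : scalar phi by exact: linearP.
rewrite -[LHS]/(eval_at m _) -[RHS]/(eval_at m _) -!slice_tmap //.
by congr (slice phi _); transitivity (eval_coeff t m); rewrite // [LHS](ft m) -(fu m).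
Qed.

Lemma hom_coact_linear c (f g : Hom) t u :
  hom_coact f t -> hom_coact g u -> hom_coact (c *: f + g) (c *: t + u).
Proof.
move=> /hom_coactE ft /hom_coactE gu; apply/hom_coactE => m.
rewrite -[(c *: f + g) m]/(c *: f m + g m) linearP ft gu.
rewrite /twist /tlift /blift scaler_sumr -big_split /=; apply: eq_bigr => p _.
rewrite -(@lmulH_bilinear k H N).2; congr (lmulH _ _).
exact/esym/(eval_coeff_linear_l p.1).
Qed.

(** Writing (rho ⊗ id) rho(f m) = (id ⊗ Delta) rho(f m) in the antipode-free
    form and cancelling the twist gives
      rho(f_0(m)) ⊗ f_1 = f_0(m_0) ⊗ m_1 f_1 ⊗ f_2,
    whose slice along phi is the identity wanted for phi(f_1) f_0. *)
Lemma hom_coact_slice (phi : {scalar H}) (f : Hom) t : hom_coact f t ->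
  hom_coact (slice phi t) (slice phi (comul_leg t)).
Proof.
have phiL : scalar phi by exact: linearP.
have rhoL := linearP (hm_coact sN); have rhoC := hm_comodule sM.
have [lBl lBr] := @lmulH_bilinear k H N.
have [lBl2 lBr2] := @lmulH_bilinear k H (N ⊗ H)%type.
have liL a : linear (tmap (lmulH a) id : (N ⊗ H) ⊗ H -> (N ⊗ H) ⊗ H).
  by apply: tmap_linear; [exact: lBr|exact: lin_id].
move=> /hom_coactE ft; apply/hom_coactE => m.
pose X m0 := comul_leg (eval_coeff t m0).
have XL : linear X := lin_comp (@comul_leg_linear k H N) (eval_coeff_linear t).
pose F m0 := tmap (hm_coact sN) id (eval_coeff t m0).
have FL : linear F.
  exact: (lin_comp (tmap_linear rhoL (@lin_id _ H)) (eval_coeff_linear t)).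
pose G m := tlift (fun (m0 : M) (m1 : H) => tmap (lmulH m1) id (X m0)) (hm_coact sM m).
have XB : bilinear_map (fun (m0 : M) (m1 : H) => tmap (lmulH m1) id (X m0)).
  split=> [m1|m0]; first exact: (lin_comp (liL m1) XL).
  by apply: lin_lift_fun => y h; apply: lin_tensl; exact: lBl.
have GL : linear G := lin_lift_arg XB (linearP _).
(* F m = rho(f_0(m)) ⊗ f_1 and G m = f_0(m_0) ⊗ m_1 f_1 ⊗ f_2. *)
have FG : F =1 G.
  apply: (twist_inj rhoC FL GL) => {}m.
  transitivity (tmap (hm_coact sN) id (hm_coact sN (f m))).
    rewrite ft [RHS](tlift_comp _ _ (tmap_linear rhoL (@lin_id _ H))).
    by apply: eq_tlift => m0 m1; rewrite lmulH_tmap.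
  rewrite (comodule_comul_leg _ (hm_comodule sN)) ft.
  rewrite [LHS](tlift_comp _ _ (@comul_leg_linear k H N)).
  transitivity (tlift (fun (m0 : M) (m1 : H) => tlift (fun a b : H =>
      lmulH b (tmap (lmulH a) id (X m0))) (comul m1)) (hm_coact sM m)).
    by apply: eq_tlift => m0 m1; exact: comul_leg_lmulH.
  rewrite (comodule_coassoc (f := fun (z : M) (a b : H) =>
    lmulH b (tmap (lmulH a) id (X z))) _ rhoC); first last.
  - by move=> z a; exact: lBl2.
  - by move=> z b; exact: (lin_comp (lBr2 b) (XB.2 z)).
  - by move=> a b; exact: (lin_comp (lBr2 b) (XB.1 a)).
  by apply: eq_tlift => m0 m1; rewrite -(tlift_comp _ _ (lBr2 m1)).
transitivity (slice phi (F m)).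
  rewrite /F slice_tmap // -[slice phi t m]/(eval_at m (slice phi t)).
  by rewrite -(slice_tmap _ (eval_at_linear m) phiL).
rewrite FG (tlift_comp _ _ (slice_linear phiL)); apply: eq_tlift => m0 m1.
rewrite slice_tmap //; congr (lmulH _ _).
have evL : linear (tmap (eval_at m0) id : Hom ⊗ H -> N ⊗ H).
  exact: (tmap_linear (eval_at_linear m0) (@lin_id _ H)).
by rewrite /eval_coeff -slice_tmap // -comul_leg_tmap.
Qed.

Lemma HOM_val_linear : linear (@HOM_val _ _ _ _ _ sM sN).
Proof. by []. Qed.

Local Notation iotaH := (tmap (@HOM_val _ _ _ _ _ sM sN) id).

Lemma slice_HOM (f : Hom) t (phi : {scalar H}) : hom_coact f t ->
  slice phi t \in @HOM_pred _ _ _ _ _ sM sN.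
Proof.
move=> ft; apply/asboolP; exists (slice phi (comul_leg t)).
exact: hom_coact_slice.
Qed.

(** f_0 ⊗ f_1 is a sum of slices tensored with elements of H, and its slices
    are in HOM. *)
Fact HOM_coact_ex (f : HOM) : exists t : HOM ⊗ H, hom_coact f (iotaH t).
Proof.
have [t ft] := asboolP _ (HOM_valP f).
have [s ts] := tensor_slices t projH.
exists (\sum_(p <- s) MkHOM (slice_HOM p.1 ft) ⊗ p.2).
suff -> : iotaH (\sum_(p <- s) MkHOM (slice_HOM p.1 ft) ⊗ p.2) = t by [].
have iL := tmap_linear HOM_val_linear (@lin_id _ H).
rewrite [RHS]ts; elim: s {ts} => [|p s IHs].
  by rewrite !big_nil (linearP0 iL).
by rewrite !big_cons (Defs.linearPD iL) IHs tmap_tens //; exact: lin_id.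
Qed.

Definition HOM_coact (f : HOM) : HOM ⊗ H := sval (cid (HOM_coact_ex f)).

Lemma HOM_coactP (f : HOM) : hom_coact f (iotaH (HOM_coact f)).
Proof. exact: svalP (cid (HOM_coact_ex f)). Qed.

Lemma HOM_coact_eq (f : HOM) t : hom_coact f (iotaH t) -> HOM_coact f = t.
Proof.
have iL := HOM_val_linear.
move=> ft; apply: (tmap_inj projH iL); first exact: val_inj.
exact: hom_coact_inj (HOM_coactP f) ft.
Qed.

Fact HOM_coact_linear : linear HOM_coact.
Proof.
move=> c f g; apply: HOM_coact_eq.
rewrite (tmap_linear HOM_val_linear (@lin_id _ H)).
exact: hom_coact_linear (HOM_coactP f) (HOM_coactP g).
Qed.
HB.instance Definition _ :=
  GRing.isLinear.Build k HOM (HOM ⊗ H)%type _ HOM_coact HOM_coact_linear.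

(** Coassociativity, tested on slices: it then says that the coaction of a
    slice of f_0 ⊗ f_1 is the one given by [hom_coact_slice]. *)
Lemma HOM_coact_comul_leg f : tmap HOM_coact id (HOM_coact f) = comul_leg (HOM_coact f).
Proof.
have iL := HOM_val_linear; have iiL := tmap_linear iL (@lin_id _ H).
apply: slice_inj => // phi; have phiL : scalar phi by exact: linearP.
rewrite (slice_tmap _ HOM_coact_linear phiL); apply: HOM_coact_eq.
rewrite -(slice_tmap _ iiL phiL) -(comul_leg_tmap _ iL) -(slice_tmap _ iL phiL).
exact: hom_coact_slice (HOM_coactP f).
Qed.

Lemma HOM_coact_comodule : is_comodule HOM_coact.
Proof.
have iL := HOM_val_linear.
split=> f.
  rewrite -[RHS](@tassocVK k HOM H H).
  by congr (tassoc _); exact: HOM_coact_comul_leg.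
have eL := linearP (@counit k H).
rewrite -/(slice _ _); do 2 apply: val_inj; apply/funext => m.
rewrite -[LHS]/(eval_at m (HOM_val (slice counit _))) -(slice_tmap _ iL eL).
rewrite -(slice_tmap _ (eval_at_linear m) eL) -/(eval_coeff _ m).
have /hom_coactE/(_ m) fm := HOM_coactP f.
transitivity (slice counit (hm_coact sN (f m))); last first.
  exact: (hm_comodule sN).2.
(* Applying the counit to rho(f m) = f_0(m_0) ⊗ m_1 f_1 separates m_1 and f_1
   because the counit is multiplicative. *)
rewrite fm [RHS](tlift_comp _ _ (slice_linear eL)) -{1}[m](hm_comodule sM).2.
rewrite (tlift_comp _ _ (lin_comp (slice_linear eL) (eval_coeff_linear _))).
apply: eq_tlift => m0 m1.
rewrite (Defs.linearPZ (eval_coeff_linear _)) (Defs.linearPZ (slice_linear eL)).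
move: (eval_coeff _ m0); apply: tensor_ext => [||n h].
- exact: lin_scale (slice_linear eL).
- exact: (lin_comp (slice_linear eL) ((@lmulH_bilinear k H N).2 m1)).
by rewrite lmulH_tens !slice_tens // counitM scalerA.
Qed.
End HomCoaction.

(** * The bimodule structure of HOM *)

Section HomBimodule.
Context {k : comPzRingType} {H : hopfAlgebra k} {A B C : comodAlgebra H}.
Context {M N : lmodType k} (sM : hopfBimodule A B M) (sN : hopfBimodule A C N).
Hypothesis projH : projective H.
Local Notation Hom := (Defs.Hom sM sN).
Local Notation HOM := (HOM sM sN).
Local Notation mulH := (fun h h' : H => h * h').

(** The axiom for bimodules at a = 1. *)
Lemma hb_coactr (D E : comodAlgebra H) (Q : lmodType k) (sQ : hopfBimodule D E Q) q e :
  hm_coact sQ (hb_ract sQ q e) =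
  tmap2 (hb_ract sQ) mulH (hm_coact sQ q) (ca_coact e).
Proof.
have [lB l1 _] := hm_lmodule sQ; have mB := mulr_bilinear H.
have := hb_coact sQ 1 q e; rewrite l1 ca_coact1 => ->.
congr (tmap2 _ _ _ _); move: (hm_coact sQ q); apply: tensor_ext => [||x h].
- exact: (tmap2_bilinear lB mB).2.
- exact: lin_id.
by rewrite tmap2_tens // l1 mul1r.
Qed.

Let rB : bilinear_map (hb_ract sM). Proof. by case: (hb_rmodule sM). Qed.
Let rC : bilinear_map (hb_ract sN). Proof. by case: (hb_rmodule sN). Qed.
Let mB : bilinear_map mulH. Proof. exact: mulr_bilinear. Qed.

Fact hom_actl_pred (b : B) (f : Hom) :
  (fun m => f (hb_ract sM m b)) \in @hom_pred _ _ _ _ _ sM sN.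
Proof.
apply/asboolP => a m m'.
by rewrite (Defs.linearPD (rB.1 b)) hb_bimodule hom_lact.
Qed.
Definition hom_actl b f : Hom := MkHom (hom_actl_pred b f).

Fact hom_actr_pred (f : Hom) (c : C) :
  (fun m => hb_ract sN (f m) c) \in @hom_pred _ _ _ _ _ sM sN.
Proof.
apply/asboolP => a m m'.
by rewrite hom_lact (Defs.linearPD (rC.1 c)) hb_bimodule.
Qed.
Definition hom_actr f c : Hom := MkHom (hom_actr_pred f c).

Lemma hom_actl_bilinear : bilinear_map hom_actl.
Proof.
split=> [f|b] x u v; apply: val_inj; apply/funext => m //=.
by rewrite (rB.2 m) (hom_linear f).
Qed.

Lemma hom_actr_bilinear : bilinear_map hom_actr.
Proof.
split=> [c|f] x u v; apply: val_inj; apply/funext => m /=.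
  exact: (rC.1 c).
exact: (rC.2 (f m)).
Qed.

Lemma eval_coeff_actl (s : B ⊗ H) (t : Hom ⊗ H) m :
  eval_coeff (tmap2 hom_actl mulH s t) m =
  tlift (fun (b : B) (h : H) => lmulH h (eval_coeff t (hb_ract sM m b))) s.
Proof.
have alB := hom_actl_bilinear; have [t2l t2r] := tmap2_bilinear alB mB.
have [lBl lBr] := @lmulH_bilinear k H N.
have eL m' := @eval_coeff_linear_l _ _ _ _ _ sM sN m'.
move: s; apply: tensor_ext => [||b h].
- exact: (lin_comp (eL m) (t2l t)).
- apply: tlift_linear; split=> [h|b]; last exact: lBl.
  exact: (lin_comp (lBr h) (lin_comp (eval_coeff_linear t) (rB.2 m))).
rewrite tlift_tens; last first.
  split=> [{}h|{}b]; last exact: lBl.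
  exact: (lin_comp (lBr h) (lin_comp (eval_coeff_linear t) (rB.2 m))).
move: t; apply: tensor_ext => [||f h'].
- exact: (lin_comp (eL m) (t2r _)).
- exact: (lin_comp (lBr h) (eL _)).
rewrite tmap2_tens // /eval_coeff !tmap_tens; try exact: lin_id; try exact: eval_at_linear.
by rewrite lmulH_tens.
Qed.

Lemma eval_coeff_actr (t : Hom ⊗ H) (s : C ⊗ H) m :
  eval_coeff (tmap2 hom_actr mulH t s) m = tmap2 (hb_ract sN) mulH (eval_coeff t m) s.
Proof.
have arB := hom_actr_bilinear; have [t2l t2r] := tmap2_bilinear arB mB.
have [u2l u2r] := tmap2_bilinear rC mB.
have eL := @eval_coeff_linear_l _ _ _ _ _ sM sN m.
move: t; apply: tensor_ext => [||f h].
- exact: (lin_comp eL (t2l s)).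
- exact: (lin_comp (u2l s) eL).
move: s; apply: tensor_ext => [||c h'].
- exact: (lin_comp eL (t2r _)).
- exact: u2r.
rewrite tmap2_tens // /eval_coeff !tmap_tens; try exact: lin_id; try exact: eval_at_linear.
by rewrite tmap2_tens.
Qed.

(** rho(f(mb)) = f_0(m_0 b_0) ⊗ m_1 b_1 f_1, so b_0 f_0 ⊗ b_1 f_1 satisfies the
    antipode-free identity for bf. *)
Lemma hom_coact_actl (b : B) (f : Hom) t : hom_coact f t ->
  hom_coact (hom_actl b f) (tmap2 hom_actl mulH (ca_coact b) t).
Proof.
have [lBl lBr] := @lmulH_bilinear k H N.
move=> /hom_coactE ft; apply/hom_coactE => m; rewrite /= ft /twist hb_coactr.
pose L (x : M ⊗ H) := tlift (fun (m0 : M) (m1 : H) => lmulH m1 (eval_coeff t m0)) x.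
have LB : bilinear_map (fun (m0 : M) (m1 : H) => lmulH m1 (eval_coeff t m0)).
  by split=> [m1|m0]; [exact: (lin_comp (lBr _) (eval_coeff_linear t))|exact: lBl].
have LL : linear L by exact: tlift_linear.
rewrite -/(L _) /tmap2 (tlift_comp _ _ LL); apply: eq_tlift => m0 m1.
rewrite eval_coeff_actl (tlift_comp _ _ LL) (tlift_comp _ _ (lBr _)).
by apply: eq_tlift => b0 b1; rewrite /L tlift_tens // lmulHA.
Qed.

Lemma hom_coact_actr (f : Hom) (c : C) t : hom_coact f t ->
  hom_coact (hom_actr f c) (tmap2 hom_actr mulH t (ca_coact c)).
Proof.
have [lBl lBr] := @lmulH_bilinear k H N.
have [u2l u2r] := tmap2_bilinear rC mB.
move=> /hom_coactE ft; apply/hom_coactE => m; rewrite /= hb_coactr ft.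
rewrite [LHS](tlift_comp _ _ (u2l _)); apply: eq_tlift => m0 m1.
rewrite eval_coeff_actr; move: (eval_coeff t m0); apply: tensor_ext => [||n h].
- exact: (lin_comp (u2l _) (lBr _)).
- exact: (lin_comp (lBr _) (u2l _)).
move: (ca_coact c); apply: tensor_ext => [||c0 c1].
- exact: u2r.
- exact: (lin_comp (lBr _) (u2r _)).
by rewrite lmulH_tens !tmap2_tens // lmulH_tens mulrA.
Qed.

Fact HOM_actl_pred b (f : HOM) : hom_actl b f \in @HOM_pred _ _ _ _ _ sM sN.
Proof.
by have [t ft] := asboolP _ (HOM_valP f); apply/asboolP; eexists; exact: hom_coact_actl ft.
Qed.
Definition HOM_actl b f : HOM := MkHOM (HOM_actl_pred b f).

Fact HOM_actr_pred (f : HOM) c : hom_actr f c \in @HOM_pred _ _ _ _ _ sM sN.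
Proof.
by have [t ft] := asboolP _ (HOM_valP f); apply/asboolP; eexists; exact: hom_coact_actr ft.
Qed.
Definition HOM_actr f c : HOM := MkHOM (HOM_actr_pred f c).

Lemma HOM_actl_bilinear : bilinear_map HOM_actl.
Proof.
split=> [f|b] x u v; apply: val_inj.
  exact: hom_actl_bilinear.1.
exact: hom_actl_bilinear.2.
Qed.

Lemma HOM_actr_bilinear : bilinear_map HOM_actr.
Proof.
split=> [f|b] x u v; apply: val_inj.
  exact: hom_actr_bilinear.1.
exact: hom_actr_bilinear.2.
Qed.

Let iL := @HOM_val_linear _ _ _ _ _ sM sN.

Lemma HOM_coact_actl b f : HOM_coact projH (HOM_actl b f) =
  tmap2 HOM_actl mulH (ca_coact b) (HOM_coact projH f).
Proof.
apply: HOM_coact_eq.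
suff -> : tmap (@HOM_val _ _ _ _ _ sM sN) id
    (tmap2 HOM_actl mulH (ca_coact b) (HOM_coact projH f)) =
    tmap2 hom_actl mulH (ca_coact b) (tmap (@HOM_val _ _ _ _ _ sM sN) id (HOM_coact projH f)).
  exact: hom_coact_actl (HOM_coactP _ _).
have iiL := tmap_linear iL (@lin_id _ H).
have AB := HOM_actl_bilinear; have aB := hom_actl_bilinear.
have [t2l t2r] := tmap2_bilinear AB mB; have [u2l u2r] := tmap2_bilinear aB mB.
move: (ca_coact b) (HOM_coact _ f) => s t.
move: s; apply: tensor_ext => [||x h]; [exact: (lin_comp iiL (t2l _))|exact: u2l|].
move: t; apply: tensor_ext => [||g h'].
- exact: (lin_comp iiL (t2r _)).
- exact: (lin_comp (u2r _) iiL).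
by rewrite tmap2_tens // !tmap_tens ?tmap2_tens //; exact: lin_id.
Qed.

Lemma HOM_coact_actr f c : HOM_coact projH (HOM_actr f c) =
  tmap2 HOM_actr mulH (HOM_coact projH f) (ca_coact c).
Proof.
apply: HOM_coact_eq.
suff -> : tmap (@HOM_val _ _ _ _ _ sM sN) id
    (tmap2 HOM_actr mulH (HOM_coact projH f) (ca_coact c)) =
    tmap2 hom_actr mulH (tmap (@HOM_val _ _ _ _ _ sM sN) id (HOM_coact projH f)) (ca_coact c).
  exact: hom_coact_actr (HOM_coactP _ _).
have iiL := tmap_linear iL (@lin_id _ H).
have AB := HOM_actr_bilinear; have aB := hom_actr_bilinear.
have [t2l t2r] := tmap2_bilinear AB mB; have [u2l u2r] := tmap2_bilinear aB mB.
move: (ca_coact c) (HOM_coact _ f) => s t.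
move: s; apply: tensor_ext => [||x h]; [exact: (lin_comp iiL (t2r _))|exact: u2r|].
move: t; apply: tensor_ext => [||g h'].
- exact: (lin_comp iiL (t2l _)).
- exact: (lin_comp (u2l _) iiL).
by rewrite tmap2_tens // !tmap_tens ?tmap2_tens //; exact: lin_id.
Qed.

Lemma HOM_ext (f g : HOM) : (forall m, f m = g m) -> f = g.
Proof. by move=> fg; do 2 apply: val_inj; apply/funext. Qed.

Fact HOM_lmodule : is_left_module HOM_actl.
Proof.
have [_ r1 rM] := hb_rmodule sM.
split; first exact: HOM_actl_bilinear.
- by move=> f; apply: HOM_ext => m; rewrite /= r1.
- by move=> a b f; apply: HOM_ext => m; rewrite /= rM.
Qed.

Fact HOM_rmodule : is_right_module HOM_actr.
Proof.
have [_ r1 rM] := hb_rmodule sN.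
split; first exact: HOM_actr_bilinear.
- by move=> f; apply: HOM_ext => m; rewrite /= r1.
- by move=> f a b; apply: HOM_ext => m; rewrite /= rM.
Qed.

Definition HOM_hopfModule : hopfModule B HOM :=
  HopfModule (hm_coact := HOM_coact projH) HOM_lmodule
    (HOM_coact_comodule sM sN projH) HOM_coact_actl.

Fact HOM_actlr b f c : HOM_actr (HOM_actl b f) c = HOM_actl b (HOM_actr f c).
Proof. by apply: HOM_ext. Qed.

Fact HOM_coact_actlr b f c : HOM_coact projH (HOM_actr (HOM_actl b f) c) =
  tmap2 HOM_actr mulH (tmap2 HOM_actl mulH (ca_coact b) (HOM_coact projH f))
    (ca_coact c).
Proof. by rewrite HOM_coact_actr HOM_coact_actl. Qed.

Definition HOM_hopfBimodule : hopfBimodule B C HOM :=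
  HopfBimodule (hb_module := HOM_hopfModule) HOM_rmodule HOM_actlr HOM_coact_actlr.
End HomBimodule.

(** * Additive maps on balanced tensor products *)

Section BTensorExt.
Context {R : Type} {M N : zmodType} {r : M -> R -> M} {l : R -> N -> N}.

Lemma morphD0 (U V : zmodType) (f : U -> V) : {morph f : x y / x + y} -> f 0 = 0.
Proof. by move=> fD; apply: (addrI (f 0)); rewrite -fD !addr0. Qed.

Lemma btensor_ext (P : zmodType) (f g : btensor r l -> P) :
  {morph f : x y / x + y} -> {morph g : x y / x + y} ->
  (forall m n, f (btens m n) = g (btens m n)) -> f =1 g.
Proof.
move=> fD gD fg.
apply: (@btensor_ind _ _ _ r l (fun x => f x = g x)) => [|x y fx fy|//].
  by rewrite (morphD0 fD) (morphD0 gD).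
by rewrite fD gD fx fy.
Qed.

Lemma btens0r m : btens m 0 = 0 :> btensor r l.
Proof.
apply: (morphD0 (f := fun n => btens m n : btensor r l)) => n n'.
exact: btensDr.
Qed.
End BTensorExt.

(** * Descent along a faithfully flat Galois extension *)

Section Galois.
Context {k : comPzRingType} {H : hopfAlgebra k} (A : comodAlgebra H).
Local Notation R := (coinvA A).

(** The restriction to A^{co H} is kept as a bare operation on X wherever only
    balanced tensors matter, and packaged as a module in [coinv_restr] where
    flatness requires one. *)
Definition coinv_lact {X : lmodType k} (act : A -> X -> X) (u : R) (x : X) : X :=
  act (coinv_val u) x.

Definition can_mod {X : lmodType k} (act : A -> X -> X) (a : A) (x : X) : X ⊗ H :=
  tmap (act^~ x) id (ca_coact a).

Section OneModule.
Context {X : lmodType k} (act : A -> X -> X) (actM : is_left_module act).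

Local Notation AX := (btensor (@coinvA_ract k H A) (coinv_lact act)).

Let actB : bilinear_map act. Proof. by case: actM. Qed.

Lemma can_mod_bilinear : bilinear_map (can_mod act).
Proof.
split=> [x|a].
  exact: (lin_comp (tmap_linear (actB.1 x) (@lin_id _ H)) (linearP ca_coact)).
by apply: lin_lift_fun => b h; apply: lin_tensl; exact: actB.2.
Qed.

Lemma can_mod_balanced :
  balanced (@coinvA_ract k H A) (coinv_lact act) (can_mod act).
Proof.
split=> [a b x|a x y|a u x].
- exact: (linearPD (can_mod_bilinear.1 x)).
- exact: (linearPD (can_mod_bilinear.2 a)).
rewrite /can_mod /coinvA_ract /coinv_lact ca_coactM.
have /coinvP-> := coinv_valP u.
have [mL _] := @tensor_mul_bilinear k A H.
have tL y : linear (tmap (act^~ y) id : A ⊗ H -> X ⊗ H).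
  exact: tmap_linear (actB.1 y) (@lin_id _ H).
have [_ _ actA] := actM.
move: (ca_coact a); apply: tensor_ext => [||b h].
- exact: (lin_comp (tL x) (mL _)).
- exact: tL.
rewrite tensor_mulE mulr1 !tmap_tens ?actA //; first exact: actB.1.
exact: actB.1.
Qed.

(** The canonical map with coefficients in X: can' is the case X = A. *)
Definition can_tensor : AX -> X ⊗ H := blift (can_mod act).

Lemma can_tensorD : {morph can_tensor : x y / x + y}.
Proof. exact: bliftD can_mod_balanced. Qed.

Lemma can_tensor_btens a x : can_tensor (btens a x) = can_mod act a x.
Proof. exact: blift_btens can_mod_balanced _ _. Qed.
End OneModule.
Arguments can_tensor {X} act z.

Lemma regular_module : is_left_module (@GRing.mul A).
Proof.
split; [exact: mulr_bilinear|exact: mul1r|].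
by move=> a b c; rewrite mulrA.
Qed.

Section GaloisModule.
Context {X : lmodType k} (act : A -> X -> X) (actM : is_left_module act).
Local Notation AX := (btensor (@coinvA_ract k H A) (coinv_lact act)).
Local Notation AA := (btensor (@coinvA_ract k H A) (@coinvA_lact k H A)).

Let actB : bilinear_map act. Proof. by case: actM. Qed.

(** a ⊗ b |-> a ⊗ bx, which carries inverse images under can' to inverse images
    under the canonical map of the module generated by x. *)
Definition push (x : X) (z : AA) : AX := blift (fun a b => btens a (act b x)) z.
Definition rmulA (c : A) (z : AA) : AA := blift (fun a b => btens a (b * c)) z.

Let push_balanced x : balanced (@coinvA_ract k H A) (@coinvA_lact k H A)
  (fun a b => btens a (act b x) : AX).
Proof.
have [_ _ actA] := actM.
split=> [a a' b|a b b'|a u b].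
- exact: btensDl.
- by rewrite (linearPD (actB.1 x)) btensDr.
- by rewrite btens_bal /coinv_lact -actA.
Qed.

Let rmulA_balanced c : balanced (@coinvA_ract k H A) (@coinvA_lact k H A)
  (fun a b => btens a (b * c) : AA).
Proof.
split=> [a a' b|a b b'|a u b].
- exact: btensDl.
- by rewrite mulrDl btensDr.
- by rewrite btens_bal /coinvA_lact mulrA.
Qed.

Let pushD x : {morph push x : z z' / z + z'}. Proof. exact: bliftD. Qed.
Let rmulAD c : {morph rmulA c : z z' / z + z'}. Proof. exact: bliftD. Qed.
Let push_btens x a b : push x (btens a b) = btens a (act b x).
Proof. exact: blift_btens. Qed.
Let rmulA_btens c a b : rmulA c (btens a b) = btens a (b * c).
Proof. exact: blift_btens. Qed.

Let can'D : {morph @can' k H A : x y / x + y}.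
Proof. exact: (can_tensorD regular_module). Qed.
Let can'_btens a b : can' (btens a b) = can_mod (@GRing.mul A) a b.
Proof. exact: (can_tensor_btens regular_module). Qed.

Let push_act x a z : push (act a x) z = push x (rmulA a z).
Proof.
have [_ _ actA] := actM.
move: z; apply: btensor_ext => [||b c].
- exact: pushD.
- by move=> z z'; rewrite rmulAD pushD.
by rewrite rmulA_btens !push_btens actA.
Qed.

Let can'_rmulA c z : can' (rmulA c z) = tmap (fun e : A => e * c) id (can' z).
Proof.
have cL d : linear (fun e : A => e * d) := (mulr_bilinear A).1 d.
have tL d : linear (tmap (fun e : A => e * d) id : A ⊗ H -> A ⊗ H).
  exact: tmap_linear (cL d) (@lin_id _ H).
move: z; apply: btensor_ext => [||a b].
- by move=> z z'; rewrite rmulAD can'D.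
- by move=> z z'; rewrite can'D (linearPD (tL c)).
rewrite rmulA_btens !can'_btens /can_mod; move: (ca_coact a).
apply: tensor_ext => [||a0 a1]; [exact: tL|exact: (lin_comp (tL c) (tL b))|].
by rewrite !tmap_tens // mulrA.
Qed.

Let can_push x z : can_tensor act (push x z) = tmap (act^~ x) id (can' z).
Proof.
have cL d : linear (fun e : A => e * d) := (mulr_bilinear A).1 d.
have tL y : linear (tmap (act^~ y) id : A ⊗ H -> X ⊗ H).
  exact: tmap_linear (actB.1 y) (@lin_id _ H).
have tL' d : linear (tmap (fun e : A => e * d) id : A ⊗ H -> A ⊗ H).
  exact: tmap_linear (cL d) (@lin_id _ H).
have [_ _ actA] := actM.
move: z; apply: btensor_ext => [||a b].
- by move=> z z'; rewrite pushD (can_tensorD actM).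
- by move=> z z'; rewrite can'D (linearPD (tL x)).
rewrite push_btens (can_tensor_btens actM) can'_btens /can_mod; move: (ca_coact a).
apply: tensor_ext => [||a0 a1]; [exact: tL|exact: (lin_comp (tL x) (tL' b))|].
have idL := @lin_id _ H; have aL := actB.1.
by rewrite !tmap_tens // actA.
Qed.

(** Since can' commutes with right multiplication on the second factor, the
    canonical map for X is can' ⊗_A X; its inverse sends x ⊗ h to
    can'^-1(1 ⊗ h) x. *)
Lemma can_tensor_bijective : bijective (@can' k H A) ->
  bijective (can_tensor act).
Proof.
case=> J canK JK.
have JD : {morph J : s t / s + t}.
  by move=> s t; apply: (can_inj canK); rewrite can'D !JK.
have [_ act1 actA] := actM.
have idL := @lin_id _ H; have aL := actB.1.
have cL d : linear (fun e : A => e * d) := (mulr_bilinear A).1 d.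
have J_rmulA c s : rmulA c (J s) = J (tmap (fun e : A => e * c) id s).
  by apply: (can_inj canK); rewrite can'_rmulA !JK.
have J1 (a : A) (h : H) : rmulA a (J ((1 : A) ⊗ h)) = J (a ⊗ h).
  by rewrite J_rmulA tmap_tens // mul1r.
have KB : balanced (fun x (a : k) => a *: x) (fun a h => a *: h)
    (fun (x : X) (h : H) => push x (J ((1 : A) ⊗ h))).
  have pushDl x y z : push (x + y) z = push x z + push y z.
    move: z; apply: btensor_ext => [||a b]; first exact: pushD.
    - by move=> z z'; rewrite !pushD addrACA.
    - by rewrite !push_btens (linearPD (actB.2 b)) btensDr.
  split=> [x x' h|x h h'|x c h]; first exact: pushDl.
  - by rewrite tensDr JD pushD.
  (* Balance over k is an instance of balance over A, as cx = (c 1) x. *)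
  have -> : c *: x = act (c *: (1 : A)) x.
    by rewrite (Defs.linearPZ (aL x)) act1.
  by rewrite push_act J1 tensZ.
pose K : X ⊗ H -> AX := blift (fun x h => push x (J ((1 : A) ⊗ h))).
have KD : {morph K : s t / s + t} := bliftD KB.
have KE x h : K (x ⊗ h) = push x (J ((1 : A) ⊗ h)) := blift_btens KB x h.
have tL y : linear (tmap (act^~ y) id : A ⊗ H -> X ⊗ H).
  exact: tmap_linear (aL y) idL.
have Ktmap x s : K (tmap (act^~ x) id s) = push x (J s).
  move: s; apply: btensor_ext => [||a h].
  - by move=> s t; rewrite (linearPD (tL x)) KD.
  - by move=> s t; rewrite JD pushD.
  by rewrite [btens a h]/(a ⊗ h) tmap_tens // KE push_act J1.
exists K.
- apply: btensor_ext => [||a x].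
  + by move=> z z'; rewrite (can_tensorD actM) KD.
  + by [].
  rewrite (can_tensor_btens actM) Ktmap.
  have -> : ca_coact a = can' (btens a 1).
    rewrite can'_btens /can_mod; move: (ca_coact a).
    apply: tensor_ext => [||a0 h]; first by [].
      exact: tmap_linear (cL 1) idL.
    by rewrite tmap_tens // mulr1.
  by rewrite canK push_btens act1.
- apply: btensor_ext => [||x h].
  + by move=> s t; rewrite KD (can_tensorD actM).
  + by [].
  by rewrite [btens x h]/(x ⊗ h) KE can_push JK tmap_tens // act1.
Qed.
End GaloisModule.

Section Restriction.
Context {X : lmodType k} (act : A -> X -> X) (actM : is_left_module act).

Definition coinv_restr of is_left_module act : Type := X.
Local Notation XR := (coinv_restr actM).
HB.instance Definition _ := GRing.Zmodule.on XR.

Let actB : bilinear_map act. Proof. by case: actM. Qed.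

Definition coinv_restr_scale (u : R) (x : XR) : XR := coinv_lact act u x.

Fact coinv_restr_scaleA u v x :
  coinv_restr_scale u (coinv_restr_scale v x) = coinv_restr_scale (u * v) x.
Proof. by have [_ _ actA] := actM; apply/esym/actA. Qed.
Fact coinv_restr_scale1 : left_id 1 coinv_restr_scale.
Proof. by have [_ act1 _] := actM; exact: act1. Qed.
Fact coinv_restr_scaleDr : right_distributive coinv_restr_scale +%R.
Proof. by move=> u x y; exact: (linearPD (actB.2 _)). Qed.
Fact coinv_restr_scaleDl x : {morph coinv_restr_scale^~ x : u v / u + v}.
Proof. by move=> u v; exact: (linearPD (actB.1 _)). Qed.
HB.instance Definition _ := GRing.Zmodule_isLmodule.Build R XR
  coinv_restr_scaleA coinv_restr_scale1 coinv_restr_scaleDr coinv_restr_scaleDl.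
End Restriction.

Section Structure.
Context {M : lmodType k} (sM : hopfModule A M).
Local Notation act := (hm_lact sM).
Local Notation rho := (hm_coact sM).
Local Notation mulH := (fun h h' : H => h * h').

Let actM : is_left_module act := hm_lmodule sM.
Let actB : bilinear_map act. Proof. by case: actM. Qed.
Let mB : bilinear_map mulH. Proof. exact: mulr_bilinear. Qed.

(** On M ⊗ H the action is a (m ⊗ h) = a_0 m ⊗ a_1 h.  With this choice rho is
    A-linear, and the canonical map for M ⊗ H transports A ⊗_R rho to rho ⊗ id
    and A ⊗_R (- ⊗ 1) to id ⊗ Delta without any antipode ([can_defect]). *)
Definition diag_act (a : A) (x : M ⊗ H) : M ⊗ H := tmap2 act mulH (ca_coact a) x.

Lemma diag_module : is_left_module diag_act.
Proof.
have [_ act1 actA] := actM; have [tL tR] := tmap2_bilinear actB mB.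
have [mL mR] := @tensor_mul_bilinear k A H.
split.
- split=> [x|a]; [exact: (lin_comp (tL x) (linearP _))|exact: tR].
- rewrite /diag_act ca_coact1; apply: tensor_ext => [||m h].
  + exact: tR.
  + exact: lin_id.
  by rewrite tmap2_tens // act1 mul1r.
move=> a b x; rewrite /diag_act ca_coactM; move: (ca_coact a) (ca_coact b) => s t.
move: s; apply: tensor_ext => [||a0 a1].
- exact: (lin_comp (tL x) (mL t)).
- exact: tL.
move: t; apply: tensor_ext => [||b0 b1].
- exact: (lin_comp (tL x) (mR _)).
- exact: (lin_comp (tR _) (tL x)).
move: x; apply: tensor_ext => [||m h].
- exact: tR.
- exact: (lin_comp (tR _) (tR _)).
by rewrite tensor_mulE !tmap2_tens // actA mulrA.
Qed.

Local Notation MR := (coinv_restr actM).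
Local Notation MHR := (coinv_restr diag_module).
Local Notation Mco := (coinvM sM).

Definition coinv_incl (m : Mco) : MR := coinv_val m.

Fact coinv_incl_linear : linear coinv_incl.
Proof. by []. Qed.
HB.instance Definition _ :=
  GRing.isLinear.Build R Mco MR _ coinv_incl coinv_incl_linear.

Definition coinv_defect (m : MR) : MHR := rho m - m ⊗ (1 : H).

Fact coinv_defect_linear : linear coinv_defect.
Proof.
move=> u m m'; rewrite /coinv_defect.
rewrite -[u *: m]/(act (coinv_val u) m) (linearPD (linearP rho)) hm_coactl.
rewrite -[u *: _]/(diag_act (coinv_val u) _) /diag_act.
have -> : (act (coinv_val u) m + m') ⊗ (1 : H) =
    tmap2 act mulH (ca_coact (coinv_val u)) (m ⊗ (1 : H)) + m' ⊗ (1 : H).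
  by have /coinvP-> := coinv_valP u; rewrite tmap2_tens // mulr1 tensDl.
have tR := (tmap2_bilinear actB mB).2 (ca_coact (coinv_val u)).
set T := tmap2 _ _ _ in tR *.
have TB x y : T (x - y) = T x - T y.
  by rewrite [x - y]addrC -scaleN1r tR scaleN1r addrC.
by rewrite opprD addrACA -TB.
Qed.
HB.instance Definition _ :=
  GRing.isLinear.Build R MR MHR _ coinv_defect coinv_defect_linear.

Local Notation AM := (btensor (@coinvA_ract k H A) (coinv_lact act)).
Local Notation AMco :=
  (btensor (@coinvA_ract k H A) (fun (u : R) (m : Mco) => u *: m)).

Lemma adj_counit_balanced :
  balanced (@coinvA_ract k H A) (fun (u : R) (m : Mco) => u *: m)
  (fun a m => act a (coinv_val m)).
Proof.
have [_ _ actA] := actM; split=> [a b m|a m m'|a u m].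
- exact: (linearPD (actB.1 _)).
- exact: (linearPD (actB.2 a)).
- exact: actA.
Qed.

(** The counit of the adjunction between A ⊗_R - and coinvariants. *)
Definition adj_counit : AMco -> M := blift (fun a m => act a (coinv_val m)).

Lemma adj_counitD : {morph adj_counit : x y / x + y}.
Proof. exact: bliftD adj_counit_balanced. Qed.

Lemma adj_counit_btens a m : adj_counit (btens a m) = act a (coinv_val m).
Proof. exact: blift_btens adj_counit_balanced _ _. Qed.

Definition incl_tensor : AMco -> AM := blift (fun a m => btens a (coinv_val m)).

Lemma incl_balanced : balanced (@coinvA_ract k H A) (fun (u : R) (m : Mco) => u *: m)
  (fun a m => btens a (coinv_val m) : AM).
Proof.
split=> [a b m|a m m'|a u m]; [exact: btensDl|exact: btensDr|exact: btens_bal].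
Qed.

(** (a m)_0 ⊗ (a m)_1 = a_0 m ⊗ a_1 for m coinvariant: under the canonical map,
    the inclusion of A ⊗_R M^{co H} into A ⊗_R M becomes rho o [adj_counit]. *)
Lemma can_incl z : can_tensor act (incl_tensor z) = rho (adj_counit z).
Proof.
have iD : {morph incl_tensor : x y / x + y} := bliftD incl_balanced.
move: z; apply: btensor_ext => [||a m].
- by move=> x y; rewrite iD (can_tensorD actM).
- by move=> x y; rewrite adj_counitD (linearPD (linearP rho)).
rewrite [incl_tensor _](blift_btens incl_balanced) (can_tensor_btens actM).
rewrite adj_counit_btens hm_coactl; have /coinvP-> := coinv_valP m.
rewrite /can_mod; move: (ca_coact a); apply: tensor_ext => [||b h].
- exact: (tmap_linear (actB.1 _) (@lin_id _ H)).
- exact: (tmap2_bilinear actB mB).1.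
by rewrite tmap2_tens // mulr1 tmap_tens //; exact: actB.1.
Qed.

Definition defect_tensor : AM -> btensor (@coinvA_ract k H A) (coinv_lact diag_act) :=
  blift (fun a m => btens a (coinv_defect m)).

Lemma can_defect y : can_tensor diag_act (defect_tensor y) =
  tmap rho id (can_tensor act y) - comul_leg (can_tensor act y).
Proof.
have dB : balanced (@coinvA_ract k H A) (coinv_lact act)
    (fun a m =>
      btens a (coinv_defect m) : btensor (@coinvA_ract k H A) (coinv_lact diag_act)).
  split=> [a b m|a m m'|a u m]; first exact: btensDl.
    have -> : coinv_defect (m + m') = coinv_defect m + coinv_defect m'.
      by have := coinv_defect_linear 1 m m'; rewrite !scale1r.
    exact: btensDr.
  have -> : coinv_defect (coinv_lact act u m) =
      coinv_lact diag_act u (coinv_defect m).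
    have := coinv_defect_linear u m 0.
    have -> : coinv_defect 0 = 0.
      by rewrite /coinv_defect linear0 tens0l subr0.
    by rewrite !addr0.
  exact: btens_bal.
have tL := tmap_linear (linearP rho) (@lin_id _ H); have pL := @comul_leg_linear k H M.
have [_ cR] := can_mod_bilinear diag_module.
move: y; apply: btensor_ext => [||a m].
- by move=> x y; rewrite [defect_tensor _](bliftD dB) (can_tensorD diag_module).
- move=> x y; rewrite (can_tensorD actM) (linearPD tL) (linearPD pL).
  by rewrite opprD addrACA.
rewrite [defect_tensor _](blift_btens dB) (can_tensor_btens diag_module).
rewrite (can_tensor_btens actM) /coinv_defect.
have -> : can_mod diag_act a (rho m - m ⊗ (1 : H)) =
    can_mod diag_act a (rho m) - can_mod diag_act a (m ⊗ (1 : H)).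
  by rewrite addrC -scaleN1r (cR a) scaleN1r addrC.
have aL := actB.1 m; have idL := @lin_id _ H.
have aiL := tmap_linear aL idL.
congr (_ - _); rewrite /can_mod.
  move: (ca_coact a); apply: tensor_ext => [||b h].
  - exact: tmap_linear ((proj1 (let: And3 B _ _ := diag_module in B)) _) idL.
  - exact: (lin_comp tL aiL).
  rewrite !tmap_tens //; last by case: diag_module => B _ _; exact: B.1.
  - by rewrite /diag_act hm_coactl.
  - exact: linearP.
rewrite comul_leg_tmap // -comodule_comul_leg; last exact: ca_comodule.
have cL := linearP (@ca_coact k H A).
move: (ca_coact a); apply: tensor_ext => [||b h].
- exact: tmap_linear ((proj1 (let: And3 B _ _ := diag_module in B)) _) idL.
- exact: (lin_comp (tmap_linear aiL idL) (tmap_linear cL idL)).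
rewrite !tmap_tens //; last by case: diag_module => B _ _; exact: B.1.
congr (_ ⊗ _); rewrite /diag_act; move: (ca_coact b).
apply: tensor_ext => [||b0 b1]; [exact: (tmap2_bilinear actB mB).1|exact: aiL|].
by rewrite tmap2_tens // tmap_tens // mulr1.
Qed.

(** Injectivity is flatness applied to 0 -> M^{co H} -> M.  For surjectivity,
    the element of A ⊗_R M that corresponds to rho(m) is killed by the defect
    map by coassociativity, so by flatness it comes from some z in
    A ⊗_R M^{co H}; then rho(adj_counit z) = rho(m), and rho is injective. *)
Theorem adj_counit_bijective : right_ff_Galois A -> bijective adj_counit.
Proof.
case=> ff can'_bij.
have canM_bij := can_tensor_bijective actM can'_bij.
have canMH_inj := bij_inj (can_tensor_bijective diag_module can'_bij).
have [K canK KK] := canM_bij.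
have rho_inj m m' : rho m = rho m' -> m = m'.
  by move=> mm'; rewrite -[m](hm_comodule sM).2 mm' (hm_comodule sM).2.
have counit_inj0 z : adj_counit z = 0 -> z = 0.
  move=> z0.
  (* The zero endomorphism of M^{co H} stands for the map from 0. *)
  have /ff/(_ z) [ex _] : exact_at (\0 : Mco -> Mco) coinv_incl.
    move=> y; split=> [y0|[x <-]] //; exists 0; apply: val_inj; exact/esym.
  have [|x <-] := ex.
    apply: (can_inj canK); rewrite [LHS]can_incl z0.
    by rewrite linear0 (morphD0 (can_tensorD actM)).
  by rewrite /blift big1 // => p _; exact: btens0r.
have counit_inj : injective adj_counit.
  move=> z z' zz'; apply/eqP; rewrite -subr_eq0; apply/eqP/counit_inj0.
  by apply: (addIr (adj_counit z')); rewrite -adj_counitD subrK add0r.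
have counit_surj m : exists z, adj_counit z = m.
  have /ff/(_ (K (rho m))) [ex _] : exact_at coinv_incl coinv_defect.
    move=> y; split=> [/eqP|[x <-]].
      by rewrite subr_eq0 => /eqP/coinvP yco; exists (Coinv yco).
    by apply/eqP; rewrite subr_eq0; apply/eqP/coinvP/coinv_valP.
  have [|z zm] := ex.
    apply: canMH_inj; rewrite [LHS]can_defect KK comodule_comul_leg ?subrr.
      by rewrite (morphD0 (can_tensorD diag_module)).
    exact: hm_comodule.
  by exists z; apply: rho_inj; rewrite -can_incl [incl_tensor z]zm KK.
exists (fun m => sval (cid (counit_surj m))) => x; last exact: svalP (cid (counit_surj x)).
by apply: counit_inj; exact: svalP (cid (counit_surj (adj_counit x))).
Qed.
End Structure.
End Galois.

(** * Extending maps between coinvariants *)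

Section Extensions.
Context {k : comPzRingType} {H : hopfAlgebra k} {A : comodAlgebra H}.
Context {M N : lmodType k} (sM : hopfModule A M) (sN : hopfModule A N).
Local Notation R := (coinvA A).
Local Notation AMco :=
  (btensor (@coinvA_ract k H A) (fun (u : R) (m : coinvM sM) => u *: m)).

Definition tensor_lact (a : A) (z : AMco) : AMco :=
  blift (fun b m => btens (a * b) m) z.

Lemma tensor_lact_balanced a : balanced (@coinvA_ract k H A)
  (fun (u : R) (m : coinvM sM) => u *: m) (fun b m => btens (a * b) m : AMco).
Proof.
split=> [b c m|b m m'|b u m]; [by rewrite mulrDr btensDl|exact: btensDr|].
by rewrite -btens_bal /coinvA_ract mulrA.
Qed.

Lemma tensor_lactD a : {morph tensor_lact a : x y / x + y}.
Proof. exact: bliftD (tensor_lact_balanced a). Qed.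

Lemma tensor_lact_btens a b m : tensor_lact a (btens b m) = btens (a * b) m.
Proof. exact: blift_btens (tensor_lact_balanced a) _ _. Qed.

Lemma adj_counit_lact a z : adj_counit (tensor_lact a z) = hm_lact sM a (adj_counit z).
Proof.
have [aB _ aA] := hm_lmodule sM; move: z; apply: btensor_ext => [||b m].
- by move=> x y; rewrite tensor_lactD adj_counitD.
- by move=> x y; rewrite adj_counitD (linearPD (aB.2 a)).
by rewrite tensor_lact_btens !adj_counit_btens aA.
Qed.

Section OneMap.
Variable g : linhom (coinvM sM) (coinvM sN).

Lemma linhomP : linear g.
Proof. exact: (asboolP _ (linhom_valP g)). Qed.

Lemma linhomD : {morph g : x y / x + y}.
Proof. by move=> x y; have := linhomP 1 x y; rewrite !scale1r. Qed.

Lemma linhomZ u x : g (u *: x) = u *: g x.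
Proof. by have := linhomP u x 0; rewrite (morphD0 linhomD) !addr0. Qed.

Definition coext (z : AMco) : N := blift (fun a m => hm_lact sN a (coinv_val (g m))) z.

Lemma coext_balanced : balanced (@coinvA_ract k H A)
  (fun (u : R) (m : coinvM sM) => u *: m)
  (fun a m => hm_lact sN a (coinv_val (g m))).
Proof.
have [aB _ aA] := hm_lmodule sN; split=> [a b m|a m m'|a u m].
- exact: (linearPD (aB.1 _)).
- by rewrite linhomD; exact: (linearPD (aB.2 a)).
- by rewrite linhomZ; exact: aA.
Qed.

Lemma coextD : {morph coext : x y / x + y}.
Proof. exact: bliftD coext_balanced. Qed.

Lemma coext_btens a m : coext (btens a m) = hm_lact sN a (coinv_val (g m)).
Proof. exact: blift_btens coext_balanced _ _. Qed.

Lemma coext_lact a z : coext (tensor_lact a z) = hm_lact sN a (coext z).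
Proof.
have [aB _ aA] := hm_lmodule sN; move: z; apply: btensor_ext => [||b m].
- by move=> x y; rewrite tensor_lactD coextD.
- by move=> x y; rewrite coextD (linearPD (aB.2 a)).
by rewrite tensor_lact_btens !coext_btens aA.
Qed.

(** An extension is forced on the image of [adj_counit], by A-linearity. *)
Lemma extension_adj_counit gt : is_extension g gt -> forall z, gt (adj_counit z) = coext z.
Proof.
move=> [gtL _ gtE].
have [_ a1 _] := hm_lmodule sM; have [_ b1 _] := hm_lmodule sN.
have gtD : {morph gt : x y / x + y} by move=> x y; have := gtL 1 x y; rewrite a1 b1.
apply: btensor_ext => [||a m].
- by move=> x y; rewrite adj_counitD gtD.
- exact: coextD.
rewrite adj_counit_btens coext_btens -gtE -[hm_lact sM a _]addr0 gtL.
by rewrite (morphD0 gtD) addr0.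
Qed.

Lemma extension_exists : right_ff_Galois A -> exists gt, is_extension g gt.
Proof.
move=> /(adj_counit_bijective sM)[nu adj_counitK nuK]; exists (coext \o nu).
have [aB a1 _] := hm_lmodule sM; have [bB b1 _] := hm_lmodule sN.
have gtL a m m' : coext (nu (hm_lact sM a m + m')) =
    hm_lact sN a (coext (nu m)) + coext (nu m').
  have -> : hm_lact sM a m + m' = adj_counit (tensor_lact a (nu m) + nu m').
    by rewrite adj_counitD adj_counit_lact !nuK.
  by rewrite adj_counitK coextD coext_lact.
have gt_lin : linear (coext \o nu).
  by move=> c m m'; rewrite -(module_actZ sM) /= gtL module_actZ.
have tL := tmap_linear gt_lin (@lin_id _ H).
split=> // m.
  rewrite -[m]nuK /= adj_counitK; move: (nu m); apply: btensor_ext => [||a x].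
  - by move=> x y; rewrite coextD (linearPD (linearP _)).
  - by move=> x y; rewrite adj_counitD (linearPD (linearP _)) (linearPD tL).
  rewrite coext_btens adj_counit_btens !hm_coactl.
  have /coinvP-> := coinv_valP x; have /coinvP-> := coinv_valP (g x).
  have mB := mulr_bilinear H.
  move: (ca_coact a); apply: tensor_ext => [||b h].
  - exact: (tmap2_bilinear bB mB).1.
  - exact: (lin_comp tL ((tmap2_bilinear aB mB).1 _)).
  rewrite !tmap2_tens // tmap_tens //=.
  by rewrite -(@adj_counit_btens _ _ _ _ sM) adj_counitK coext_btens.
by rewrite /= -[coinv_val m]a1 -(@adj_counit_btens _ _ _ _ sM) adj_counitK coext_btens b1.
Qed.

Lemma extension_unique gt gt' : right_ff_Galois A ->
  is_extension g gt -> is_extension g gt' -> gt = gt'.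
Proof.
move=> /(adj_counit_bijective sM)[nu _ nuK] ext ext'; apply/funext => m.
by rewrite -[m]nuK !extension_adj_counit.
Qed.
End OneMap.
End Extensions.

(** * Coinvariants of HOM and restriction *)

Section HomCoinvariants.
Context {k : comPzRingType} {H : hopfAlgebra k} {A : comodAlgebra H}.
Context {M N : lmodType k} (sM : hopfModule A M) (sN : hopfModule A N).
Local Notation HOM := (HOM sM sN).

Definition colinear (f : M -> N) :=
  forall m, hm_coact sN (f m) = tmap f id (hm_coact sM m).

(** The antipode-free identity for f ⊗ 1 reads rho(f m) = f(m_0) ⊗ m_1. *)
Lemma colinearE (f : Defs.Hom sM sN) :
  colinear f <-> hom_coact f (f ⊗ (1 : H)).
Proof.
rewrite hom_coactE; split=> fE m; rewrite fE; apply: eq_tlift => m0 m1.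
  by rewrite /eval_coeff tmap_tens // lmulH_tens mulr1.
by rewrite /eval_coeff tmap_tens // lmulH_tens mulr1.
Qed.

Lemma colinear_coinv (f : M -> N) (m : M) : colinear f -> linear f ->
  m \in coinvariant (hm_coact sM) -> f m \in coinvariant (hm_coact sN).
Proof.
move=> fE fL /coinvP mP; apply/coinvP.
by rewrite fE mP tmap_tens //; exact: lin_id.
Qed.

Lemma HOM_coinvE (projH : projective H) (f : HOM) :
  f \in coinvariant (HOM_coact projH) <-> colinear f.
Proof.
have iL := @HOM_val_linear _ _ _ _ _ sM sN; have idL := @lin_id _ H.
have fE : tmap (@HOM_val _ _ _ _ _ sM sN) id (f ⊗ (1 : H)) = HOM_val f ⊗ (1 : H).
  by rewrite tmap_tens.
rewrite colinearE -fE; split=> [/coinvP/= <-|ft].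
  exact: HOM_coactP.
by apply/coinvP; exact: HOM_coact_eq.
Qed.
End HomCoinvariants.

Section Restriction.
Context {k : comPzRingType} {H : hopfAlgebra k} {A B C : comodAlgebra H}.
Context {M N : lmodType k} (sM : hopfBimodule A B M) (sN : hopfBimodule A C N).
Hypothesis projH : projective H.
Local Notation X := (HOM_hopfBimodule sM sN projH).
Local Notation Mco := (coinvM sM).
Local Notation Nco := (coinvM sN).
Implicit Types f : coinvB X.

Lemma coinvB_colinear f : colinear sM sN (coinv_val f).
Proof. by apply/(HOM_coinvE projH); exact: coinv_valP. Qed.

Lemma restr_coinv f (m : Mco) :
  HOM_val (coinv_val f) (coinv_val m) \in coinvariant (hm_coact sN).
Proof.
apply: (colinear_coinv (coinvB_colinear f) (hom_linear _)).
exact: coinv_valP.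
Qed.

Fact beta_linear f : (fun m : Mco => Coinv (restr_coinv f m) : Nco) \in
  @linhom_pred _ Mco Nco.
Proof. by apply/asboolP => u m m'; apply: val_inj; exact: hom_lact. Qed.

Definition beta f : linhom Mco Nco := LinHom (beta_linear f).

Lemma betaE f m : coinv_val (beta f m) = HOM_val (coinv_val f) (coinv_val m).
Proof. by []. Qed.

Lemma betaD f f' : beta (f + f') = beta f + beta f'.
Proof.
apply: (@val_inj _ _ (linhom Mco Nco)).
apply/funext => m.
apply: (@val_inj _ _ (coinv (hm_coact sN))).
rewrite [LHS]betaE.
rewrite -[RHS]/(coinv_val (beta f m) + coinv_val (beta f' m)).
rewrite !betaE.
have -> : coinv_val (f + f') = coinv_val f + coinv_val f' by [].
have -> : forall h h' : HOM sM sN, HOM_val (h + h') = HOM_val h + HOM_val h' by [].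
by [].
Qed.

Lemma beta_extension f : is_extension (beta f) (coinv_val f).
Proof. by split=> //; [exact: hom_lact|exact: coinvB_colinear]. Qed.

(** Every extension lies in HOM, with coaction gt ⊗ 1, so it is a coinvariant
    and a preimage of g under restriction. *)
Lemma extension_HOM g (gt : M -> N) : is_extension g gt ->
  exists f, HOM_val (coinv_val f) = gt :> (M -> N) /\ beta f = g.
Proof.
case=> gtL gtE gtg.
have gtP : gt \in @hom_pred _ _ _ _ _ sM sN by apply/asboolP.
have gtC : MkHom gtP \in @HOM_pred _ _ _ _ _ sM sN.
  by apply/asboolP; exists (MkHom gtP ⊗ (1 : H)); apply/colinearE.
have gtco : MkHOM gtC \in coinvariant (hm_coact X) by apply/HOM_coinvE.
exists (Coinv gtco : coinvB X); split=> //.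
by apply: val_inj; apply/funext => m; apply: val_inj; exact: gtg.
Qed.

Lemma beta_bijective : right_ff_Galois A -> bijective beta.
Proof.
move=> galA.
have beta_surj g : exists f, beta f = g.
  by have [gt /extension_HOM[f []]] := extension_exists g galA; exists f.
have beta_inj : injective beta.
  move=> f f' ff'; apply: val_inj; apply: HOM_ext => m.
  have ext := beta_extension f; rewrite ff' in ext.
  by have -> := extension_unique galA ext (beta_extension f').
exists (fun g => sval (cid (beta_surj g))) => x; last exact: svalP (cid (beta_surj x)).
by apply: beta_inj; exact: svalP (cid (beta_surj (beta x))).
Qed.

Lemma beta_scale (x : cotensor B C) f (m : Mco) : coinv_val (beta (x *: f) m) =
  tlift (fun (b : B) (c : C) =>
    hb_ract sN (HOM_val (coinv_val f) (hb_ract sM (coinv_val m) b)) c)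
    (cotensor_val x).
Proof.
rewrite betaE.
have evL : linear (fun h : HOM sM sN => HOM_val h (coinv_val m)) by [].
exact: (tlift_comp _ _ evL).
Qed.
End Restriction.

Theorem proposition4p8 (k : comPzRingType) (H : hopfAlgebra k)
    (projH : projective H) (A B C : comodAlgebra H) (M N : lmodType k)
    (sM : hopfBimodule A B M) (sN : hopfBimodule A C N) :
  exists X : hopfBimodule B C (HOM sM sN),
  [/\ forall (b : B) (f : HOM sM sN) (c : C) (m : M),
        HOM_val (hb_ract X (hm_lact X b f) c) m
        = hb_ract sN (HOM_val f (hb_ract sM m b)) c,
      forall f : HOM sM sN,
        hom_coact (HOM_val f) (tmap (@HOM_val _ _ _ _ _ sM sN) id (hm_coact X f))
    & exists beta : coinvB X -> linhom (coinvM sM) (coinvM sN),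
      (forall (f : coinvB X) (m : coinvM sM),
        coinv_val (beta f m) = HOM_val (coinv_val f) (coinv_val m)) /\
      (right_ff_Galois A ->
        (forall g : linhom (coinvM sM) (coinvM sN),
          exists! gt : M -> N, is_extension g gt) /\
        (exists act : cotensor B C -> linhom (coinvM sM) (coinvM sN) ->
                      linhom (coinvM sM) (coinvM sN),
          [/\ forall (x : cotensor B C) (g : linhom (coinvM sM) (coinvM sN))
                (gt : M -> N), is_extension g gt ->
                forall m : coinvM sM,
                coinv_val (act x g m) =
                tlift (fun (b : B) (c : C) =>
                  hb_ract sN (gt (hb_ract sM (coinv_val m) b)) c)
                  (cotensor_val x),
              is_module_action act,
              forall f f' : coinvB X, beta (f + f') = beta f + beta f',
              forall (x : cotensor B C) (f : coinvB X),
                beta (x *: f) = act x (beta f)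
            & bijective beta]))].
Proof.
exists (HOM_hopfBimodule sM sN projH); split=> //.
  exact: HOM_coactP.
exists (@beta _ _ _ _ _ _ _ sM sN projH); split=> // galA; split=> [g|].
  have [gt ext] := extension_exists g galA; exists gt; split=> // gt'.
  exact: extension_unique.
have [gamma betaK gammaK] := beta_bijective sM sN projH galA.
(* Transport of structure: the action formula then has to be checked only on
   the image of beta, where the extension of g is the coinvariant itself. *)
exists (fun x g => beta (x *: gamma g)); split.
- move=> x _ _ /(extension_HOM projH)[f [<- <-]] m.
  by rewrite betaK beta_scale.
- split=> [x y g|g|x y g|x g g'].
  + by rewrite betaK scalerA.
  + by rewrite scale1r gammaK.
  + by rewrite scalerDl betaD.
  + rewrite -betaD -scalerDr; congr (beta (_ *: _)).
    by apply: (can_inj betaK); rewrite gammaK betaD !gammaK.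
- exact: betaD.
- by move=> x f; rewrite betaK.
- exact: beta_bijective.
Qed.
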